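(* Let $\phi$ be an acyclic Sturmian coloring of the $d$-regular tree $T$, with quotient graph $(X,\phi)$. Fix a vertex $t\in VT$, let $n_k$, $\alpha_k$ and $\beta_k=\beta_k(t)$ be the sequences associated with $\phi$ in the context, and let $(Y,\varphi)=\varinjlim\mathcal G^{\beta_k}_{n_k}$. Then $(Y,\varphi)$ is equal to $(X,\phi)$, i.e. isomorphic to it as a colored edge-indexed graph.
   Context: Balls and Sturmian colorings. $T$ is a $d$-regular tree with vertex set $VT$ and path metric. For $\phi:VT\to\{a,b\}$, $\mathcal B_n(x)$ is the closed $n$-ball around $x$, colored by $\phi$; two $n$-balls are equivalent if there is a color-preserving isomorphism of balls between them (center to center); $[\mathcal B_n(x)]$ is the class, $\mathbf B_n(\phi)$ the set of classes. $\phi$ is Sturmian if $|\mathbf B_n(\phi)|=n+2$ for all $n\ge0$. Then for each $n\ge0$ there is a unique class $S_n$ (special $n$-ball) which is the restriction to the concentric $n$-ball of two distinct classes $A_{n+1},B_{n+1}$ of $(n+1)$-balls; any other class $D$ of $n$-balls has a unique extension $\overline D$ to an $(n+1)$-ball class. $C_n$ is the central $n$-ball of $S_{n+1}$. $X=G\backslash T$, where $G$ is the group of $\phi$-preserving automorphisms of $T$; it is colored by $\phi$ and edge-indexed: the index from $x$ to $y$ is the number of neighbors in the class $y$ of a lift of $x$. Naming: colors are named so that $S_0=A_0=[a]$, $B_0=[b]$. $D$ is always adjacent to $E$ if every ball of class $D$ has its center at distance 1 from the center of some ball of class $E$. Inductively $A_{n+1}$ is always adjacent to $A_n$, $B_{n+1}$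 to $B_n$, and the center of $A_{n+1}$ has more neighbors with $n$-ball in class $A_n$ than that of $B_{n+1}$. Graphs. $\mathcal G_n$ has vertex set $\mathbf B_n(\phi)$, with an edge between $D,E$ if there are $x,y\in VT$ at distance 1 with $[\mathcal B_n(x)]=D,[\mathcal B_n(y)]=E$. A cycle has length $>1$; $\phi$ is acyclic if no $\mathcal G_n$ has a cycle. For $X\neq S_n$, $i_A(X,Y)=i_B(X,Y)$ is the number of $n$-balls of class $Y$ centered at neighbors of the center of a ball of class $X$; $i_A(S_n,Y)$ (resp. $i_B(S_n,Y)$) is the number of those centered at neighbors of the center of $A_{n+1}$ (resp. $B_{n+1}$). $\mathcal G^A_n$ is the edge-indexed graph on the classes reachable from $S_n$ by oriented edges of positive $i_A$, with the oriented edges (and loops) of positive $i_A$, indexed by $i_A$; $\mathcal G^B_n$ likewise with $i_B$. A vertex is colored by the color of the center of the ball. Sequences. $n_0<n_1<\cdots$ are the integers $n\ge0$ such that at least one of $A_n,B_n$ equals $S_n$ or $C_n$. $\alpha_k=A$ if $|V\mathcal G^A_{n_k}|\ge|V\mathcal G^B_{n_k}|$ and $\alpha_k=B$ otherwise; $\overline A=B$, $\overline B=A$. For $t\in VT$ and $k\ge1$: $\beta_{k-1}(t)=\overline{\alpha_k}$ if $[\mathcal B_{n_k}(t)]\in V\mathcal G^{\overline{\alpha_k}}_{n_k}$, and $\beta_{k-1}(t)=\alpha_k$ otherwise. (One has $\beta_k\in\{\alpha_k,\beta_{k-1}\}$.) Direct limit. For $*\in\{A,B\}$ the extension map on $V\mathcal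 G^*_n$ sends $U\ne S_n$ to $\overline U$ and $S_n$ to $A_{n+1}$ if $*=A$, to $B_{n+1}$ if $*=B$. The transition map $V\mathcal G^{\beta_k}_{n_k}\to V\mathcal G^{\beta_{k+1}}_{n_{k+1}}$ is the composition of the extension maps for $*=\beta_k$ from level $n_k$ to level $n_{k+1}$. $\varinjlim\mathcal G^{\beta_k}_{n_k}$ has as vertices the direct limit of the vertex sets, with inherited coloring, and as edge indices the eventual values of the indices. *)

(* Defs.v *)
From mathcomp Require Import all_boot.
From mathcomp Require Import finmap.
From mathcomp Require Import boolp classical_sets functions cardinality.

Set Implicit Arguments.
Unset Strict Implicit.
Unset Printing Implicit Defensive.

Local Open Scope classical_set_scope.

(* Quotient of T by an equivalence relation: a point is an equivalence class. *)
Definition quot (T : Type) (R : T -> set T) : Type :=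
  {C : set T | exists x, C = R x}.

Definition quot_rep (T : Type) (R : T -> set T) (q : quot R) : T :=
  projT1 (cid (proj2_sig q)).

(* Colored edge-indexed graphs: there is an edge (or loop) from x to y
   exactly when vindex x y is positive. *)
Record indexed_graph := IndexedGraph {
  vertex : Type;
  vcolor : vertex -> bool;
  vindex : vertex -> vertex -> nat }.

Definition isomorphic (G H : indexed_graph) : Prop :=
  exists f : vertex G -> vertex H,
    [/\ bijective f,
        forall u, vcolor (f u) = vcolor u
      & forall u v, vindex (f u) (f v) = vindex u v].

(* Sequences of colored edge-indexed graphs with maps between their vertex
   sets; the vertices of all stages lie in a common type, and the data are only
   meaningful on them. *)
Record system := System {
  carrier : Type;
  stage : nat -> set carrier;
  transition : nat -> carrier -> carrier;
  stage_color : nat -> carrier -> bool;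
  stage_index : nat -> carrier -> carrier -> nat }.

Section DirectLimit.
Variable G : system.

Definition push (k m : nat) (u : carrier G) : carrier G :=
  iteri (m - k) (fun j => transition (k + j)) u.

Definition stage_vertex : Type := {p : nat * carrier G | stage p.1 p.2}.

Definition push_vertex (p : stage_vertex) (m : nat) : carrier G :=
  push (sval p).1 m (sval p).2.

Definition same_limit (p : stage_vertex) : set stage_vertex :=
  [set q | exists m, [/\ (sval p).1 <= m, (sval q).1 <= m
                       & push_vertex p m = push_vertex q m]].

Definition eventual_index (p q : stage_vertex) : set nat :=
  [set v | exists M, forall m, M <= m ->
    stage_index m (push_vertex p m) (push_vertex q m) = v].

(* The maps are maps of colored vertex sets between consecutive stages, and
   the edge indices stabilize: the direct limit makes sense. *)
Definition has_direct_limit : Prop :=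
  [/\ forall k u, @stage G k u -> stage k.+1 (transition k u),
      forall k u, @stage G k u ->
        stage_color k.+1 (transition k u) = stage_color k u
    & forall p q : stage_vertex, eventual_index p q !=set0].

Definition direct_limit : indexed_graph :=
  {| vertex := quot same_limit;
     vcolor := fun u =>
       stage_color (sval (quot_rep u)).1 (sval (quot_rep u)).2;
     vindex := fun u v =>
       xget 0 (eventual_index (quot_rep u) (quot_rep v)) |}.

End DirectLimit.

Section Trees.
Variables (V : choiceType) (e : rel V).

Definition regular_tree (d : nat) : Prop :=
  [/\ symmetric e, irreflexive e,
      forall x, ([set y | e x y] #= `I_d)%card,
      forall x y, exists2 p, path e x p & last x p = y
    & forall c, ucycle e c -> size c <= 2].

Definition vball (n : nat) (x : V) : set V :=
  [set y | exists p, [/\ path e x p, last x p = y & size p <= n]].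

Definition nb_neighbors (x : V) (E : set V) : nat :=
  #|` fset_set [set y | e x y /\ E y]|.

(* The value of nb_neighbors x E at a point x of D; only used when it does not
   depend on that point. *)
Definition class_index (D E : set V) : nat :=
  xget 0 [set m | exists2 x, D x & nb_neighbors x E = m].

Definition always_adjacent (D E : set V) : Prop :=
  forall x, D x -> exists2 y, e x y & E y.

Variable phi : V -> bool.

Definition ball_equiv (n : nat) (x y : V) : Prop :=
  exists f : V -> V,
    [/\ set_bij (vball n x) (vball n y) f, f x = y,
        forall u v, vball n x u -> vball n x v -> e (f u) (f v) = e u v
      & forall u, vball n x u -> phi (f u) = phi u].

(* A class of n-balls is encoded by the set of all the centers of its balls.
   As the encoding forgets n, classes are only compared at the same level. *)
Definition ball_class (n : nat) (x : V) : set V := [set y | ball_equiv n x y].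

Definition ball_classes (n : nat) : set (set V) := range (ball_class n).

Definition sturmian : Prop := forall n, (ball_classes n #= `I_n.+2)%card.

Definition class_color (D : set V) : bool := `[< exists2 x, D x & phi x >].

Definition ball_adj (n : nat) : rel (set V) := fun D E =>
  `[< exists x y, [/\ e x y, ball_class n x = D & ball_class n y = E] >].

(* The graphs have at most one edge between two vertices, hence a cycle other
   than a loop has at least 3 vertices. *)
Definition acyclic : Prop :=
  forall n c, ucycle (ball_adj n) c -> size c <= 2.

(* The class D of n-balls is the restriction of the class E of (n+1)-balls. *)
Definition extends (n : nat) (D E : set V) : Prop :=
  exists x, ball_class n x = D /\ ball_class n.+1 x = E.

Definition automorphism (g : V -> V) : Prop :=
  [/\ bijective g, forall x y, e (g x) (g y) = e x y
    & forall x, phi (g x) = phi x].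

Definition aut_orbit (x : V) : set V :=
  [set y | exists2 g, automorphism g & g x = y].

Definition quotient_graph : indexed_graph :=
  {| vertex := quot aut_orbit;
     vcolor := fun D => phi (quot_rep D);
     vindex := fun D E => nb_neighbors (quot_rep D) (sval E) |}.

(* a is the color whose 0-ball is special, ~~ a is the color b. *)
Record naming (a : bool) (Sp A B : nat -> set V) : Prop := Naming {
  naming_A0 : A 0 = [set x | phi x = a];
  naming_B0 : B 0 = [set x | phi x = ~~ a];
  naming_S0 : Sp 0 = A 0;
  naming_A : forall n, extends n (Sp n) (A n.+1);
  naming_B : forall n, extends n (Sp n) (B n.+1);
  naming_AB : forall n, A n.+1 <> B n.+1;
  naming_adjA : forall n, always_adjacent (A n.+1) (A n);
  naming_adjB : forall n, always_adjacent (B n.+1) (B n);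
  naming_lt : forall n x y, A n.+1 x -> B n.+1 y ->
    nb_neighbors y (A n) < nb_neighbors x (A n) }.

Variables Sp A B : nat -> set V.

(* The letters A and B are represented by true and false. *)
Definition ball_AB (s : bool) : nat -> set V := if s then A else B.

Definition Cn (n : nat) : set V :=
  xget set0 [set D | extends n D (Sp n.+1)].

Definition idx (s : bool) (n : nat) (D E : set V) : nat :=
  class_index (if D == Sp n then ball_AB s n.+1 else D) E.

Definition arc (s : bool) (n : nat) : rel (set V) := fun D E =>
  `[< [/\ ball_classes n D, ball_classes n E & 0 < idx s n D E] >].

Definition VG (s : bool) (n : nat) : set (set V) :=
  [set D | exists2 p, path (arc s n) (Sp n) p & last (Sp n) p = D].

Definition ext (s : bool) (n : nat) (D : set V) : set V :=
  if D == Sp n then ball_AB s n.+1 else xget set0 [set E | extends n D E].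

Definition critical (n : nat) : Prop :=
  [\/ A n = Sp n, A n = Cn n, B n = Sp n | B n = Cn n].

(* n_k is the critical integer with exactly k critical integers below it. *)
Definition level (k : nat) : nat :=
  xget 0 [set n | critical n /\
                  count (fun m => `[< critical m >]) (iota 0 n) = k].

Definition alpha (k : nat) : bool :=
  (VG false (level k) #<= VG true (level k))%card.

Definition beta (t : V) (k : nat) : bool :=
  if `[< VG (~~ alpha k.+1) (level k.+1) (ball_class (level k.+1) t) >]
  then ~~ alpha k.+1 else alpha k.+1.

Definition ball_system (t : V) : system :=
  {| carrier := set V;
     stage := fun k => VG (beta t k) (level k);
     transition := fun k =>
       iteri (level k.+1 - level k) (fun j => ext (beta t k) (level k + j));
     stage_color := fun=> class_color;
     stage_index := fun k => idx (beta t k) (level k) |}.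

End Trees.

(* Main.v *)
(* Encoded as sets of centers, the classes of (n+1)-balls are those of n-balls,
   except that S_n is cut into A_(n+1) and B_(n+1). A neighbor of S_n in G_n
   other than A_n, B_n is adjacent to both halves, and as G_(n+1) has no cycle,
   a class outside S_n adjacent to both halves can only be S_(n+1). Hence G^A_n
   is all of G_n as soon as it contains B_n, the critical levels are those at
   which G^A_n or G^B_n is all of G_n, and the part of T covered by G^A_n does
   not grow from n to n+1 unless G^A_(n+1) is all of G_(n+1).

   Consequently the letters beta_k end up always choosing the half of S_n that
   contains t. Two distinct adjacent classes of G^s_n stay adjacent when they
   are refined along the letter s, because in a tree an edge from S_n to a
   vertex of G^s_n is an arc of G^s_n. So the property of being followed by the
   letters passes from a vertex of T to its neighbors, and every vertex of T is
   followed from some level on; conversely a vertex of the limit is joined to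
   that of t by a chain of classes that stay adjacent, so local finiteness
   produces a point of T in all its refinements. The limit of the classes of x
   is their intersection, which is the orbit of x by compactness, and the
   indices converge to the numbers of neighbors in an orbit. *)

Require Import Defs.
From mathcomp Require Import all_boot.
From mathcomp Require Import finmap.
From mathcomp Require Import boolp classical_sets functions cardinality filter.

Set Implicit Arguments.
Unset Strict Implicit.
Unset Printing Implicit Defensive.

Local Open Scope classical_set_scope.

(** * Balls, their classes and orbits *)

Section Balls.
Variables (V : choiceType) (e : rel V) (phi : V -> bool).
Hypothesis nbrs_finite : forall x, finite_set [set y | e x y].

Definition ball_iso (n : nat) (x y : V) (f : V -> V) : Prop :=
  [/\ set_bij (vball e n x) (vball e n y) f, f x = y,
      forall u v, vball e n x u -> vball e n x v -> e (f u) (f v) = e u v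
    & forall u, vball e n x u -> phi (f u) = phi u].

Lemma vball_refl n x : vball e n x x.
Proof. by exists [::]. Qed.

Lemma vball_trans m n x y z :
  vball e m x y -> vball e n y z -> vball e (m + n) x z.
Proof.
move=> [p [px <- pm]] [q [qy <- qn]]; exists (p ++ q); split.
- by rewrite cat_path px.
- by rewrite last_cat.
- by rewrite size_cat leq_add.
Qed.

Lemma vball1 x y : e x y -> vball e 1 x y.
Proof. by move=> exy; exists [:: y]; rewrite /= exy. Qed.

Lemma vball_leq m n x y : m <= n -> vball e m x y -> vball e n x y.
Proof. by move=> mn [p [px lx pm]]; exists p; split=> //; exact: leq_trans mn. Qed.

Lemma vballS n x z : vball e n.+1 x z ->
  z = x \/ exists2 y, e x y & vball e n y z.
Proof.
move=> [[|y p] [/= px lx pn]]; first by left.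
by right; case/andP: px => exy py; exists y => //; exists p.
Qed.

Lemma vball_finite n x : finite_set (vball e n x).
Proof.
elim: n x => [|n IH] x.
  apply: (@sub_finite_set _ _ [set x]); last exact: finite_set1.
  by move=> y [[|z p] [_ /= <- //]].
apply: (@sub_finite_set _ _ ([set x] `|` \bigcup_(y in [set y | e x y]) vball e n y)).
  by move=> z /vballS [->|[y exy yz]]; [left | right; exists y].
by rewrite finite_setU; split; [exact: finite_set1 | exact: bigcup_finite].
Qed.

(** A path of length at most j issued from u stays within distance i + j of x, where f preserves
    edges; each edge of the path moves one unit from j to i. *)
Lemma ball_iso_vball n x y f i j u v : ball_iso n x y f ->
  vball e i x u -> i + j <= n -> vball e j u v -> vball e j (f u) (f v).
Proof.
move=> [_ _ fe _] xu ijn [p [pu lv pj]].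
elim: p u i j xu ijn pu lv pj => [|w p IH] u i j xu ijn /= pu lv pj.
  by rewrite -lv; exact: vball_refl.
case/andP: pu => uw pw; case: j => [|j] in ijn pj *; first by [].
have xw : vball e i.+1 x w by rewrite -addn1; apply: (vball_trans xu); exact: vball1.
have [q [qw ql qj]] : vball e j (f w) (f v).
  by apply: (IH w i.+1 j) => //; rewrite addSnnS.
exists (f w :: q); split=> //=; rewrite qw andbT fe ?uw //.
  by apply: vball_leq xu; apply: leq_trans ijn; exact: leq_addr.
by apply: vball_leq xw; apply: leq_trans ijn; rewrite -addSnnS leq_addr.
Qed.

Lemma ball_iso_inv n x y f : ball_iso n x y f -> exists g,
  [/\ ball_iso n y x g, forall u, vball e n x u -> g (f u) = u
    & forall v, vball e n y v -> f (g v) = v].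
Proof.
move=> [[f1 f2 f3] fx fe fp].
have /choice[g gP] v : exists u, vball e n y v -> vball e n x u /\ f u = v.
  have [yv|nyv] := pselect (vball e n y v); last by exists x.
  by have [u xu <-] := f3 _ yv; exists u.
have fK u : vball e n x u -> g (f u) = u.
  move=> xu; have [xg fg] := gP _ (f1 _ xu).
  by apply: f2 => //; rewrite inE.
exists g; split=> //; last by move=> v /gP[].
split.
- split.
  + by move=> v /gP[].
  + move=> u v; rewrite !inE => /gP[_ fu] /gP[_ fv] guv.
    by rewrite -fu -fv guv.
  + by move=> u xu; exists (f u); [exact: f1 | exact: fK].
- by rewrite -fx fK //; exact: vball_refl.
- by move=> u v /gP[xu fu] /gP[xv fv]; rewrite -fe // fu fv.
- by move=> u /gP[xu fu]; rewrite -fp // fu.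
Qed.

Lemma ball_iso_restrict n x y f i j u : ball_iso n x y f ->
  vball e i x u -> i + j <= n -> ball_iso j u (f u) f.
Proof.
move=> iso xu ijn; have [g [isog fK gK]] := ball_iso_inv iso.
have sub z : vball e j u z -> vball e n x z.
  by move=> uz; apply: vball_leq ijn _; exact: vball_trans uz.
have [[f1 f2 f3] fx fe fp] := iso.
have yfu : vball e i y (f u).
  rewrite -fx; apply: (ball_iso_vball iso (vball_refl 0 x)) xu.
  by rewrite add0n; apply: leq_trans ijn; exact: leq_addr.
have xnu : vball e n x u by apply: vball_leq xu; apply: leq_trans ijn; exact: leq_addr.
split=> //.
- split.
  + by move=> v uv; exact: (ball_iso_vball iso xu ijn).
  + move=> v w; rewrite !inE => uv uw; apply: f2; rewrite inE; exact: sub.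
  + move=> v fuv; have yv : vball e n y v by apply: vball_leq ijn _; exact: vball_trans fuv.
    exists (g v); last exact: gK.
    by rewrite -[u]fK //; exact: (ball_iso_vball isog yfu ijn).
- by move=> v w /sub xv /sub xw; exact: fe.
- by move=> v /sub xv; exact: fp.
Qed.

Lemma ball_equiv_refl n x : ball_equiv e phi n x x.
Proof.
by exists id; split=> //; split=> // u ?; exists u.
Qed.

Lemma ball_equiv_sym n x y : ball_equiv e phi n x y -> ball_equiv e phi n y x.
Proof. by move=> [f /ball_iso_inv[g [isog _ _]]]; exists g. Qed.

Lemma ball_equiv_trans n y x z :
  ball_equiv e phi n x y -> ball_equiv e phi n y z -> ball_equiv e phi n x z.
Proof.
move=> [f [fb fx fe fp]] [g [gb gy ge gp]]; exists (g \o f).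
have fy u : vball e n x u -> vball e n y (f u).
  by move=> xu; have [h _ _] := fb; exact: h.
split.
- exact: set_bij_comp gb.
- by rewrite /= fx.
- by move=> u v xu xv; rewrite /= ge ?fe //; exact: fy.
- by move=> u xu; rewrite /= gp ?fp //; exact: fy.
Qed.

Local Notation cl := (ball_class e phi).

Lemma ball_class_eq n x y : cl n x = cl n y <-> ball_equiv e phi n x y.
Proof.
split=> [xy|xy].
  have : cl n y y by exact: ball_equiv_refl.
  by rewrite -xy.
apply/seteqP; split=> z /=.
  by apply: ball_equiv_trans; exact: ball_equiv_sym.
exact: ball_equiv_trans.
Qed.

Lemma ball_class_self n x : cl n x x.
Proof. exact: ball_equiv_refl. Qed.

Lemma ball_classP n x y : cl n x y <-> cl n y = cl n x.
Proof.
by split=> [xy|/ball_class_eq/ball_equiv_sym]; [apply/esym/ball_class_eq|].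
Qed.

Lemma ball_class_leq m n x y : m <= n -> cl n x = cl n y -> cl m x = cl m y.
Proof.
move=> mn /ball_class_eq[f iso]; apply/ball_class_eq; exists f.
have [_ fx _ _] := iso; rewrite -fx.
exact: (ball_iso_restrict iso (vball_refl 0 x)).
Qed.

(** The n-ball around a neighbor of x lies in the (n+1)-ball around x, so f and its inverse preserve
    membership in a union E of classes of n-balls. *)
Lemma ball_iso_nbrs n x y f E : ball_iso n.+1 x y f ->
  (forall u v, E u -> ball_equiv e phi n u v -> E v) ->
  f @` [set u | e x u /\ E u] = [set v | e y v /\ E v].
Proof.
move=> iso Ecl.
have EfE h z w u : ball_iso n.+1 z w h -> e z u -> E u -> e w (h u) /\ E (h u).
  move=> isoh zu Eu; have zu1 := vball1 zu; have [_ hz he _] := isoh; split.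
    by rewrite -hz he //; [exact: vball_refl | exact: vball_leq zu1].
  by apply: (Ecl _ _ Eu); exists h; exact: (ball_iso_restrict isoh zu1).
have [g [isog _ gK]] := ball_iso_inv iso.
apply/seteqP; split=> [_ [u [xu Eu] <-]|v [yv Ev]]; first exact: EfE iso xu Eu.
exists (g v); last by apply: gK; apply: vball_leq (vball1 yv).
exact: EfE isog yv Ev.
Qed.

Lemma nbrs_in_finite x E : finite_set [set u | e x u /\ E u].
Proof. by apply: sub_finite_set (nbrs_finite x) => y []. Qed.

Lemma nb_neighbors_gt0 x E :
  (0 < nb_neighbors e x E) <-> exists2 y, e x y & E y.
Proof.
rewrite /nb_neighbors cardfs_gt0; split=> [/fset0Pn[y]|[y xy Ey]].
  rewrite in_fset_set; last exact: nbrs_in_finite.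
  by rewrite inE => -[? ?]; exists y.
apply/fset0Pn; exists y; rewrite in_fset_set; last exact: nbrs_in_finite.
by rewrite inE.
Qed.

Lemma nb_neighbors_le x E F : (forall y, e x y -> E y -> F y) ->
  nb_neighbors e x E <= nb_neighbors e x F.
Proof.
move=> EF; apply: fsubset_leq_card; rewrite -fset_set_sub;
  [|exact: nbrs_in_finite|exact: nbrs_in_finite].
by move=> y [xy Ey]; split=> //; exact: EF.
Qed.

Lemma nb_neighbors_class n x y z : cl n.+1 x = cl n.+1 y ->
  nb_neighbors e x (cl n z) = nb_neighbors e y (cl n z).
Proof.
move=> /ball_class_eq[f iso].
apply/fcard_eq; [exact: nbrs_in_finite|exact: nbrs_in_finite|].
rewrite -(ball_iso_nbrs (E := cl n z) iso); last first.
  by move=> u v zu uv; exact: ball_equiv_trans uv.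
rewrite card_eq_sym; apply: inj_card_eq => u v; rewrite !inE => -[xu _] [xv _].
have [[_ finj _] _ _ _] := iso.
by apply: finj; rewrite inE; apply: (@vball_leq 1) => //; exact: vball1.
Qed.

(** Each of these finitely many vertices that is not equivalent to y at all levels ceases to be so
    at some level; N is a common bound. *)
Lemma nbrs_separate x y : exists N, forall u, u = x \/ e x u ->
  forall m, N <= m -> cl m u = cl m y -> forall k, cl k u = cl k y.
Proof.
have : finite_set [set u | u = x \/ e x u].
  apply: (@sub_finite_set _ _ ([set x] `|` [set u | e x u])) => [u []|]; first by left.
    by right.
  by rewrite finite_setU; split; [exact: finite_set1|].
move=> /finite_fsetP[X XE].
have /choice[N NP] u : exists N, forall m, N <= m -> cl m u = cl m y ->
    forall k, cl k u = cl k y.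
  have [h|h] := pselect (forall k, cl k u = cl k y); first by exists 0.
  move/existsNP: h => [N hN]; exists N => m Nm uy.
  by case: hN; exact: ball_class_leq uy.
exists (\max_(u <- X) N u) => u xu m Nm; apply: NP; apply: leq_trans Nm.
suff uX : u \in X by rewrite (big_rem _ uX) /= leq_maxl.
by move: xu; rewrite -[_ \/ _]/([set u | u = x \/ e x u] u) XE.
Qed.

(** * Limits of ball isomorphisms *)

Lemma ultra_finite (I T : Type) (U : set_system I) (f : I -> T) (F : set T) :
  UltraFilter U -> finite_set F -> U [set i | F (f i)] ->
  exists v, U [set i | f i = v].
Proof.
move=> UU /finite_setP[n]; elim: n F => [|n IH] F.
  rewrite II0 card_eq0 => /eqP ->; rewrite -[[set _ | _]]/set0 => U0.
  by case: (@filter_not_empty _ U _).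
move=> /eq_cardSP[x Fx Fn UF].
have [Ux|Ux] := in_ultra_setVsetC [set i | f i = x] UU; first by exists x.
by apply: IH Fn _; near do split.
Unshelve. all: by end_near. Qed.

Lemma orbit_class n x y : aut_orbit e phi x y -> cl n x = cl n y.
Proof.
move=> [g [[h gK hK] ge gp] gx]; apply/ball_class_eq; exists g.
have gpath k z w : (forall u v, e (k u) (k v) = e u v) ->
    vball e n z w -> vball e n (k z) (k w).
  move=> ke [p [zp <- pn]]; exists (map k p); split; last by rewrite size_map.
    by elim: p z zp {pn} => //= v p IH z /andP[zv vp]; rewrite ke zv IH.
  by rewrite last_map.
have he u v : e (h u) (h v) = e u v by rewrite -ge !hK.
split=> //; split.
- by move=> u xu; rewrite -gx; exact: gpath.
- by move=> u v _ _ /(can_inj gK).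
- by move=> v yv; exists (h v); rewrite ?hK // -[x]gK gx; exact: gpath.
Qed.

(* The automorphism is the limit along an ultrafilter of the isomorphisms
   between the balls: on each finite ball only finitely many values occur. *)
Lemma class_orbit x y : (forall z w, exists n, vball e n z w) ->
  (forall n, cl n x = cl n y) -> aut_orbit e phi x y.
Proof.
move=> conn xy.
have /choice[f isof] n : exists f, ball_iso n x y f by apply/ball_class_eq.
have /choice[h hP] n : exists g, [/\ ball_iso n y x g,
   forall u, vball e n x u -> g (f n u) = u
 & forall v, vball e n y v -> f n (g v) = v] by exact: ball_iso_inv (isof n).
have [U [UU sU]] := ultraFilterLemma eventually_filter.
have large N : U [set n | N <= n] by apply: sU; exists N.
have limit (k : nat -> V -> V) a b : (forall n, ball_iso n a b (k n)) ->
    forall u, exists v, U [set n | k n u = v].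
  move=> isok u; have [i au] := conn a u.
  apply: (ultra_finite UU (vball_finite i b)).
  apply: filterS (large i) => n /= ni.
  have [_ kx _ _] := isok n; rewrite -kx.
  exact: (ball_iso_vball (isok n) (vball_refl 0 a) _ au).
have /choice[g gP] := limit _ _ _ isof.
have /choice[k kP] := limit _ _ _ (fun n => let: And3 H _ _ := hP n in H).
have nonempty A : U A -> A !=set0 by move=> /filter_ex.
(* Each identity to be checked involves finitely many limit values, all attained at a common n. *)
have near2 u v : exists n, [/\ f n u = g u, f n v = g v, h n u = k u,
    vball e n x u /\ vball e n x v & vball e n y u].
  have [i xu] := conn x u; have [j xv] := conn x v; have [l yu] := conn y u.
  have [n /= [[[[? ?] ?] [ni nj]] nl]] := nonempty _ (filterI (filterI (filterI (filterI
    (gP u) (gP v)) (kP u)) (filterI (large i) (large j))) (large l)).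
  by exists n; split=> //; [split|]; [exact: vball_leq xu|exact: vball_leq xv|
    exact: vball_leq yu].
have gK v : g (k v) = v.
  have [i xkv] := conn x (k v); have [l yv] := conn y v.
  have [n /= [[fn hn] ln]] := nonempty _ (filterI (filterI (gP (k v)) (kP v)) (large l)).
  have [_ _ fh] := hP n; rewrite -fn -hn fh //; exact: vball_leq yv.
have ginj : injective g.
  move=> u v guv; have [n [fu fv _ [xu xv] _]] := near2 u v.
  by have [[_ finj _] _ _ _] := isof n; apply: finj; rewrite ?inE //; rewrite fu fv.
exists g; last first.
  have [n [<- _ _ _ _]] := near2 x x; by have [] := isof n.
split.
- by exists k => // u; apply: ginj.
- move=> u v; have [n [<- <- _ [xu xv] _]] := near2 u v.
  by have [_ _ fe _] := isof n; exact: fe.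
- move=> u; have [n [<- _ _ [xu _] _]] := near2 u u.
  by have [_ _ _ fp] := isof n; exact: fp.
Qed.

End Balls.

(** * The splitting of the special class *)

Section SturmianClasses.
Variables (V : choiceType) (e : rel V) (phi : V -> bool) (a : bool).
Variables (Sp A B : nat -> set V).
Hypothesis e_sym : symmetric e.
Hypothesis e_irr : irreflexive e.
Hypothesis nbrs_finite : forall x, finite_set [set y | e x y].
Hypothesis conn : forall x y, exists2 p, path e x p & last x p = y.
Hypothesis sturm : sturmian e phi.
Hypothesis acyc : acyclic e phi.
Hypothesis nam : naming e phi a Sp A B.

Local Notation cl := (ball_class e phi).
Local Notation P := (ball_classes e phi).
Local Notation adj := (ball_adj e phi).
Local Notation AB := (ball_AB A B).
Local Notation arc := (Defs.arc e phi Sp A B).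
Local Notation VG := (Defs.VG e phi Sp A B).
Local Notation nb := (nb_neighbors e).

Lemma mem_classes n x : P n (cl n x).
Proof. by exists x. Qed.
Local Hint Resolve mem_classes : core.

Lemma classesE n D x : P n D -> D x -> D = cl n x.
Proof. by move=> [y _ <-] /ball_classP ->. Qed.

Lemma classes_neq0 n D : P n D -> D !=set0.
Proof. by move=> [x _ <-]; exists x; exact: ball_class_self. Qed.

Lemma classes_eq n D E x : P n D -> P n E -> D x -> E x -> D = E.
Proof. by move=> PD PE /(classesE PD) -> /(classesE PE) ->. Qed.

Lemma color_class0 x : cl 0 x = [set y | phi y = phi x].
Proof.
have vb0 u v : vball e 0 u v <-> v = u.
  by split=> [[[|z p] [_ <- h]]|->] //; exact: vball_refl.
apply/seteqP; split=> y /=.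
  by move=> [f [_ fx _ fp]]; rewrite -fx fp //; exact: vball_refl.
move=> pyx; exists (fun=> y); split=> //.
- split=> [u _|u v|v /vb0 ->]; first exact: vball_refl.
    by rewrite !inE => /vb0 -> /vb0 ->.
  by exists x => //; exact: vball_refl.
- by move=> u v /vb0 -> /vb0 ->; rewrite !e_irr.
- by move=> u /vb0 ->.
Qed.

Lemma special_classes n : P n (Sp n).
Proof. by have [x [<- _]] := naming_A nam n. Qed.
Local Hint Resolve special_classes : core.

Lemma extends_AB s n : extends e phi n (Sp n) (AB s n.+1).
Proof. by case: s; [exact: naming_A nam n | exact: naming_B nam n]. Qed.

Lemma adjacent_AB s n : always_adjacent e (AB s n.+1) (AB s n).
Proof. by case: s; [exact: naming_adjA nam n | exact: naming_adjB nam n]. Qed.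

Lemma AB0 s : AB s 0 = [set x | phi x = (if s then a else ~~ a)].
Proof. by case: s; [exact: naming_A0 nam | exact: naming_B0 nam]. Qed.

Lemma AB_classes s n : P n (AB s n).
Proof.
case: n => [|n]; last by have [x [_ <-]] := extends_AB s n.
have [x [_ xs]] := extends_AB s 0.
have [|y _ ys] := @adjacent_AB s 0 x.
  by rewrite -xs; exact: ball_class_self.
exists y => //; rewrite color_class0; move: ys; rewrite AB0 => /= ->.
by [].
Qed.
Local Hint Resolve AB_classes : core.

Lemma AB_sub s n : AB s n.+1 `<=` Sp n.
Proof.
have [x [<- <-]] := extends_AB s n.
by move=> y /ball_classP yx; apply/ball_classP; exact: ball_class_leq yx.
Qed.

Lemma AB_neq s n : AB s n <> AB (~~ s) n.
Proof.
have tf : AB true n <> AB false n.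
  case: n => [|n]; last exact: naming_AB nam n.
  have [x xA] := classes_neq0 (AB_classes true 0) => AB; move: (xA).
  by rewrite AB; move: xA; rewrite !AB0 /= => ->; case: (a).
by case: s => // /esym.
Qed.

(** Counting: without [AB s n.+1] there remain n+2 classes of (n+1)-balls. They still restrict onto
    the n+2 classes of n-balls, because the other half also restricts to [Sp n]; so restriction is
    injective on them. *)
Lemma restrict_inj s n x y : cl n x = cl n y ->
  cl n.+1 x <> AB s n.+1 -> cl n.+1 y <> AB s n.+1 -> cl n.+1 x = cl n.+1 y.
Proof.
move=> xy xs ys.
have fin m : finite_set (P m) by apply/finite_setP; exists m.+2; exact: sturm.
have cardP m : #|` fset_set (P m)| = m.+2 by apply: card_fset_set; exact: sturm.
(* Restriction to concentric n-balls, in terms of centers: saturation under n-equivalence. *)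
pose r E : set V := [set v | exists2 u, E u & ball_equiv e phi n u v].
have rE z : r (cl n.+1 z) = cl n z.
  apply/seteqP; split=> v /=.
    move=> [u /ball_classP uz uv]; apply/ball_classP.
    by rewrite -(ball_class_leq (leqnSn n) uz); apply/esym/ball_class_eq.
  by move=> zv; exists z => //; exact: ball_equiv_refl.
pose X := (fset_set (P n.+1) `\ AB s n.+1)%fset.
have XE E : (E \in X) = (E != AB s n.+1) && (E \in P n.+1).
  by rewrite in_fsetD1 in_fset_set.
have cardX : #|` X| = n.+2.
  have := cardfsD1 (AB s n.+1) (fset_set (P n.+1)).
  by rewrite cardP in_fset_set // mem_set // => -[].
have sub : (fset_set (P n) `<=` [fset r E | E in X])%fset.
  apply/fsubsetP => D; rewrite in_fset_set // => /set_mem[z _ <-].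
  have [zs|zs] := pselect (cl n.+1 z = AB s n.+1); last first.
    apply/imfsetP; exists (cl n.+1 z) => /=; last by rewrite rE.
    by rewrite XE mem_set // andbT; apply/eqP.
  have [w [wS ws]] := extends_AB (~~ s) n.
  apply/imfsetP; exists (cl n.+1 w) => /=; last first.
    rewrite rE wS; apply/esym; apply: classesE => //.
    by apply: (@AB_sub s); rewrite -zs; exact: ball_class_self.
  by rewrite XE mem_set // andbT ws; apply/eqP => /esym; exact: AB_neq.
have inj : {in X &, injective r}.
  apply/card_in_imfsetP; rewrite eqn_leq leq_imfset_card cardX -(cardP n).
  exact: fsubset_leq_card.
by apply: inj; rewrite ?XE ?mem_set ?andbT //; [apply/eqP|apply/eqP|rewrite !rE].
Qed.

(** By [restrict_inj] for both letters, each half must be the class of x or that of y. *)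
Lemma split_class n x y : cl n x = cl n y -> cl n.+1 x <> cl n.+1 y ->
  Sp n x /\ exists s, cl n.+1 x = AB s n.+1 /\ cl n.+1 y = AB (~~ s) n.+1.
Proof.
move=> xy nxy.
have some s : cl n.+1 x = AB s n.+1 \/ cl n.+1 y = AB s n.+1.
  have [|xs] := pselect (cl n.+1 x = AB s n.+1); first by left.
  have [|ys] := pselect (cl n.+1 y = AB s n.+1); first by right.
  by case: nxy; exact: restrict_inj xs ys.
suff [s [xs ys]] : exists s, cl n.+1 x = AB s n.+1 /\ cl n.+1 y = AB (~~ s) n.+1.
  by split; [apply: (@AB_sub s); rewrite -xs; exact: ball_class_self | exists s].
have [xt|yt] := some true; have [xf|yf] := some false.
- by case: (@AB_neq true n.+1); rewrite -xt.
- by exists true.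
- by exists false.
- by case: (@AB_neq true n.+1); rewrite -yt.
Qed.

Lemma next_class n x : ~ Sp n x -> cl n.+1 x = cl n x.
Proof.
move=> nx; apply/seteqP; split=> y /ball_classP yx; apply/ball_classP.
  exact: ball_class_leq yx.
by apply: contrapT => nyx; case: nx; have [] := split_class (esym yx) (nesym nyx).
Qed.

Lemma special_next n x : Sp n x -> exists s, AB s n.+1 x.
Proof.
move=> Sx; have [xt|xt] := pselect (cl n.+1 x = AB true n.+1).
  by exists true; rewrite -xt; exact: ball_class_self.
have [y [yS yt]] := extends_AB true n.
have [||_ [[] [xs ys]]] := @split_class n x y.
- by rewrite yS; apply/esym/classesE.
- by rewrite yt.
- by [].
- by exists false; rewrite -xs; exact: ball_class_self.
Qed.

Lemma special_or s n x : Sp n x -> ~ AB s n.+1 x -> AB (~~ s) n.+1 x.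
Proof. by move=> /special_next[[] ?]; case: s. Qed.

(* The refinement of the class D of n-balls selected by the letter s. As classes
   are sets of centers, it is D itself unless D is special. *)
Definition refine (s : bool) (n : nat) (D : set V) : set V :=
  if D == Sp n then AB s n.+1 else D.

Lemma refine_special s n : refine s n (Sp n) = AB s n.+1.
Proof. by rewrite /refine eqxx. Qed.

Lemma refine_other s n D : D <> Sp n -> refine s n D = D.
Proof. by rewrite /refine => /eqP/negbTE ->. Qed.

Lemma refine_sub s n D : refine s n D `<=` D.
Proof. by rewrite /refine; case: eqP => [->|_] x; [exact: AB_sub|]. Qed.

Lemma classes_next n D : P n D -> D <> Sp n -> P n.+1 D.
Proof.
move=> PD DS; have [x Dx] := classes_neq0 PD.
rewrite (classesE PD Dx) -next_class // => Sx.
by apply: DS; exact: (classes_eq PD _ Dx Sx).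
Qed.

Lemma refine_classes s n D : P n D -> P n.+1 (refine s n D).
Proof.
move=> PD; have [->|DS] := pselect (D = Sp n); first by rewrite refine_special.
by rewrite refine_other //; exact: classes_next.
Qed.
Local Hint Resolve refine_classes : core.

Lemma refine_class s n x : (Sp n x -> AB s n.+1 x) ->
  cl n.+1 x = refine s n (cl n x).
Proof.
move=> h; have [Sx|Sx] := pselect (Sp n x).
  by rewrite -(classesE (special_classes n) Sx) refine_special
    -(classesE (AB_classes s n.+1) (h Sx)).
rewrite refine_other ?next_class // => xS; case: Sx; rewrite -xS.
exact: ball_class_self.
Qed.

Lemma classes_prev n D : P n.+1 D -> D <> AB true n.+1 -> D <> AB false n.+1 ->
  P n D /\ D <> Sp n.
Proof.
move=> PD Dt Df; have [x Dx] := classes_neq0 PD.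
have Sx : ~ Sp n x.
  move=> /special_next[s sx].
  have : D = AB s n.+1 by exact: (classes_eq PD _ Dx sx).
  by case: s {sx}.
rewrite (classesE PD Dx) next_class //; split=> // xS; apply: Sx.
by rewrite -xS; exact: ball_class_self.
Qed.

(** * Edge indices, arcs and adjacency of classes *)

Lemma nb_const n D E x y : P n.+1 D -> P n E -> D x -> D y -> nb x E = nb y E.
Proof.
move=> PD [z _ <-] Dx Dy; apply: nb_neighbors_class => //.
by rewrite -(classesE PD Dx) -(classesE PD Dy).
Qed.

Lemma class_indexE n D E x : P n.+1 D -> P n E -> D x ->
  class_index e D E = nb x E.
Proof.
move=> PD PE Dx; rewrite /class_index; case: xgetP => [_ -> [y Dy <-]|/(_ (nb x E))].
  exact: (nb_const PD PE Dy Dx).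
by move=> []; exists x.
Qed.

Lemma idxE s n D E x : P n D -> P n E -> refine s n D x ->
  idx e Sp A B s n D E = nb x E.
Proof. by move=> PD PE; exact: (class_indexE (refine_classes s PD) PE). Qed.

Lemma arcP s n D E : arc s n D E <->
  [/\ P n D, P n E & forall x, refine s n D x -> exists2 y, e x y & E y].
Proof.
split=> [/asboolP[PD PE i]|[PD PE h]].
  by split=> // x Rx; apply/nb_neighbors_gt0 => //; rewrite -(idxE PD PE Rx).
apply/asboolP; split=> //; have [x Rx] := classes_neq0 (refine_classes s PD).
by rewrite (idxE PD PE Rx); apply/nb_neighbors_gt0 => //; exact: h.
Qed.

(** One point suffices, as the number of neighbors in a class of n-balls is constant on the class
    [refine s n D] of (n+1)-balls. *)
Lemma arcI s n D E x y : P n D -> P n E -> refine s n D x -> e x y -> E y ->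
  arc s n D E.
Proof.
move=> PD PE Rx xy Ey; apply/arcP; split=> // z Rz.
apply/nb_neighbors_gt0 => //; rewrite (nb_const (x := z) (y := x) _ PE _ Rx) //.
  by apply/nb_neighbors_gt0 => //; exists y.
exact: refine_classes.
Qed.

Lemma adjP n D E :
  adj n D E <-> [/\ P n D, P n E & exists x y, [/\ D x, E y & e x y]].
Proof.
split=> [/asboolP[x [y [xy <- <-]]]|[PD PE [x [y [Dx Ey xy]]]]].
  by split=> //; exists x, y; split=> //; exact: ball_class_self.
apply/asboolP; exists x, y.
by rewrite (classesE PD Dx) (classesE PE Ey).
Qed.

Lemma adj_sym n D E : adj n D E -> adj n E D.
Proof.
move/adjP=> [PD PE [x [y [Dx Ey xy]]]]; apply/adjP; split=> //.
by exists y, x; rewrite e_sym.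
Qed.

Lemma arc_adj s n D E : arc s n D E -> adj n D E.
Proof.
move/arcP=> [PD PE h]; apply/adjP; split=> //.
have [x Rx] := classes_neq0 (refine_classes s PD).
by have [y xy Ey] := h x Rx; exists x, y; split=> //; exact: refine_sub Rx.
Qed.

Lemma adj_arc s n D E : D <> Sp n -> adj n D E -> arc s n D E.
Proof.
move=> DS /adjP[PD PE [x [y [Dx Ey xy]]]]; apply: arcI xy Ey => //.
by rewrite refine_other.
Qed.

Lemma arc_AB s n : arc s n (Sp n) (AB s n).
Proof. by apply/arcP; rewrite refine_special; split=> //; exact: adjacent_AB. Qed.

(* As Z is also a class of (n-1)-balls, the points of S_n all have the same
   number of neighbors in Z. *)
Lemma arc_common s n Z : adj n (Sp n) Z -> Z <> AB true n -> Z <> AB false n ->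
  arc s n (Sp n) Z.
Proof.
move=> /adjP[_ PZ [x [y [Sx Zy xy]]]] Zt Zf.
have Pn : exists m, P m Z /\ n = m.+1.
  case: n Sx PZ Zt Zf => [|n] Sx PZ Zt Zf.
    exfalso; have : Z = AB true 0 \/ Z = AB false 0; last by case.
    have [pa|pa] := eqVneq (phi y) a.
      by left; apply: (classes_eq PZ _ Zy) => //; rewrite AB0.
    right; apply: (classes_eq PZ _ Zy) => //; rewrite AB0 /=.
    by case: (phi y) (a) pa => [] [].
  by exists n; have [] := classes_prev PZ Zt Zf.
case: Pn => m [PmZ nm]; rewrite nm in Sx PZ Zt Zf *.
have [z sz] := classes_neq0 (AB_classes s m.+2).
have [w zw Zw] : exists2 w, e z w & Z w.
  apply/nb_neighbors_gt0 => //.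
  rewrite (nb_const (D := Sp m.+1) (y := x) _ PmZ) //; last exact: AB_sub sz.
  by apply/nb_neighbors_gt0 => //; exists y.
by apply: (arcI (x := z) _ PZ _ zw Zw) => //; rewrite refine_special.
Qed.

Lemma connected_ind (Q : V -> Prop) x :
  Q x -> (forall y z, Q y -> e y z -> Q z) -> forall z, Q z.
Proof.
move=> Qx Qe z; have [p] := conn x z.
by elim: p x Qx => [|y p IH] x Qx /= => [_ <- //|/andP[xy] /IH]; apply; exact: Qe xy.
Qed.

(** * Classes reachable along the arcs of one letter *)

Lemma VG_special s n : VG s n (Sp n).
Proof. by exists [::]. Qed.
Local Hint Resolve VG_special : core.

Lemma VG_arc s n D E : VG s n D -> arc s n D E -> VG s n E.
Proof.
by move=> [p pp <-] DE; exists (rcons p E); rewrite ?last_rcons // rcons_path pp.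
Qed.

Lemma VG_ind s n (Q : set V -> Prop) : Q (Sp n) ->
  (forall D E, VG s n D -> Q D -> arc s n D E -> Q E) ->
  forall D, VG s n D -> Q D.
Proof.
move=> QS Qe D [p + <-]; elim/last_ind: p => //= p E IH.
rewrite rcons_path last_rcons => /andP[pp arcE].
by apply: (Qe (last (Sp n) p)) => //; [exists p | exact: IH].
Qed.

Lemma VG_classes s n D : VG s n D -> P n D.
Proof. by apply: VG_ind => // C E _ _ /arcP[]. Qed.

(** The half [AB s n.+1] is one arc away from [Sp n.+1]. A target E other than [Sp n] is still a
    class at level n.+1, adjacent to the refined source; if that source is [Sp n.+1], the edge is an
    arc by [arc_common]. *)
Lemma refine_VG s n D : VG s n D -> VG s n.+1 (refine s n D).
Proof.
have VA : VG s n.+1 (AB s n.+1) by apply: VG_arc (arc_AB _ _).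
move: D; apply: VG_ind => [|D E VD VrD DE]; first by rewrite refine_special.
have [->|ES] := pselect (E = Sp n); first by rewrite refine_special.
have PE := VG_classes (VG_arc VD DE).
have PE1 := classes_next PE ES.
rewrite refine_other //; apply: (VG_arc VrD).
have EA s' : E <> AB s' n.+1.
  have [x sx] := classes_neq0 (AB_classes s' n.+1) => EA.
  apply: ES; apply: (classes_eq (x := x) PE (special_classes n)).
    by rewrite EA.
  exact: AB_sub sx.
have PD := refine_classes s (VG_classes VD).
have [x Dx] := classes_neq0 PD.
have /arcP[_ _ /(_ x Dx)[y xy Ey]] := DE.
have rDE : adj n.+1 (refine s n D) E by apply/adjP; split=> //; exists x, y.
have [rDS|rDS] := pselect (refine s n D = Sp n.+1); last exact: adj_arc.
by rewrite rDS in rDE *; exact: arc_common.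
Qed.

Definition full s n : Prop := forall x, VG s n (cl n x).

Lemma full_classes s n D : full s n -> P n D -> VG s n D.
Proof. by move=> f [x _ <-]. Qed.

(** An edge that is not an arc for s can only go from [Sp n] to [AB (~~ s) n]. Once the latter is
    reached, connectedness of the tree gives every class. *)
Lemma full_other s n : VG s n (AB (~~ s) n) -> full s n.
Proof.
move=> VB; have [x0 Sx0] := classes_neq0 (special_classes n).
apply: (@connected_ind (fun x => VG s n (cl n x)) x0) => [|y z Vy yz].
  by rewrite -(classesE (special_classes n) Sx0).
have yz' : adj n (cl n y) (cl n z).
  by apply/adjP; split=> //; exists y, z; split=> //; exact: ball_class_self.
have [yS|yS] := pselect (cl n y = Sp n); last by apply: (VG_arc Vy); exact: adj_arc.
rewrite yS in yz'.
have VA : VG s n (AB s n) by apply: VG_arc (arc_AB _ _).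
have [zt|zt] := pselect (cl n z = AB true n).
  by rewrite zt; case: (s) VA VB.
have [zf|zf] := pselect (cl n z = AB false n).
  by rewrite zf; case: (s) VA VB.
by apply: (VG_arc (VG_special s n)); exact: arc_common.
Qed.

(** An edge leaving a vertex of [Sp n] gives an arc for the letter of the half containing that
    vertex; elsewhere edges are arcs for both letters. *)
Lemma VG_cover s n x : VG s n (cl n x) \/ VG (~~ s) n (cl n x).
Proof.
have [x0 Sx0] := classes_neq0 (special_classes n).
pose Q x := VG s n (cl n x) \/ VG (~~ s) n (cl n x).
apply: (@connected_ind Q x0) => {x} [|y z Vy yz].
  by left; rewrite -(classesE (special_classes n) Sx0).
have yz' : adj n (cl n y) (cl n z).
  by apply/adjP; split=> //; exists y, z; split=> //; exact: ball_class_self.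
have [Sy|Sy] := pselect (Sp n y); last first.
  have yS : cl n y <> Sp n by move=> yS; apply: Sy; rewrite -yS; exact: ball_class_self.
  by case: Vy => Vy; [left|right]; apply: (VG_arc Vy); exact: adj_arc.
have arcz r : AB r n.+1 y -> VG r n (cl n z).
  move=> ry; apply: (VG_arc (VG_special r n)).
  apply: (arcI _ _ _ yz (ball_class_self _ _ _ _)) => //.
  by rewrite refine_special.
have [sy|sy] := pselect (AB s n.+1 y); first by left; exact: arcz.
by right; apply: arcz; exact: special_or.
Qed.

(** A graph that is not full avoids [AB (~~ s) n.+1]. Its classes other than [AB s n.+1] are then
    nonspecial classes of n-balls, and edges towards them come from arcs at level n. *)
Lemma VG_prev s n x : ~ full s n.+1 -> VG s n.+1 (cl n.+1 x) -> VG s n (cl n x).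
Proof.
move=> nf; suff H : forall D, VG s n.+1 D -> forall x, D x -> VG s n (cl n x).
  by move=> Vx; exact: (H _ Vx _ (ball_class_self _ _ _ _)).
have VS z : Sp n z -> VG s n (cl n z).
  by move=> Sz; rewrite -(classesE (special_classes n) Sz).
have AS r z : AB r n.+1 z -> VG s n (cl n z) by move=> /AB_sub; exact: VS.
have nfB E : VG s n.+1 E -> E <> AB (~~ s) n.+1.
  by move=> VE EB; apply: nf; apply: full_other; rewrite -EB.
(* One step from D to E, where D is the selected half or a nonspecial class already reached at level
   n. Only adjacency is assumed, so arcs may be reversed. *)
have toE D E : (refine s n (Sp n) = D \/ D <> Sp n /\ VG s n D) -> P n.+1 E ->
    adj n.+1 D E -> E <> AB (~~ s) n.+1 -> forall z, E z -> VG s n (cl n z).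
  move=> HD PE DE EB z Ez.
  have [EA|EA] := pselect (E = AB s n.+1); first by apply: (AS s); rewrite -EA.
  have [PnE ES] : P n E /\ E <> Sp n by apply: classes_prev => //; case: (s) EA EB.
  rewrite -(classesE PnE Ez).
  have /adjP[_ _ [u [v [Du Ev uv]]]] := DE.
  case: HD => [rD|[DS VD]].
    by apply: (VG_arc (VG_special s n)); apply: (arcI _ _ _ uv Ev); rewrite ?rD.
  by apply: (VG_arc VD); apply: (arcI (VG_classes VD) _ _ uv Ev); rewrite ?refine_other.
(* The starting class [Sp n.+1] is itself reached from the selected half, against the arc of
   [arc_AB]. *)
apply: VG_ind => [z Sz|D E VD QD DE].
  have [St|St] := pselect (Sp n.+1 = AB s n.+1); first by apply: (AS s); rewrite -St.
  apply: (toE (AB s n.+1) _ _ _ _ _ _ Sz) => //; first by left; rewrite refine_special.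
    by apply: adj_sym; apply: arc_adj (arc_AB s n.+1).
  exact: nfB.
have VE := VG_arc VD DE.
apply: (toE D _ _ _ (arc_adj DE)); [|exact: VG_classes VE|exact: nfB].
have [DA|DA] := pselect (D = AB s n.+1); first by left; rewrite refine_special.
right; have [PnD DS] : P n D /\ D <> Sp n.
  by apply: classes_prev; [exact: VG_classes VD| |]; move: (nfB _ VD) DA; case: (s).
split=> //; have [z Dz] := classes_neq0 PnD.
by rewrite (classesE PnD Dz); exact: QD.
Qed.

(* If D = S_n, a path of arcs from S_n to E other than the edge itself would
   close a cycle. *)
Lemma VG_adj_arc s n D E : VG s n D -> VG s n E -> D <> E -> adj n D E ->
  arc s n D E.
Proof.
move=> _ [p pp pE] DE DadjE.
have [DS|] := pselect (D = Sp n); last by move=> DS; exact: adj_arc.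
rewrite {D}DS in DE DadjE *.
move: pE; case/shortenP: pp => q qp qu _ qE.
case: q qp qu qE => [|F q] qp qu qE; first by case: DE.
case: q qp qu qE => [|G q] qp qu qE; first by move: qp; rewrite /= -qE /= andbT.
have /(@acyc n) : ucycle (adj n) (Sp n :: F :: G :: q); last by [].
rewrite /ucycle qu andbT /cycle rcons_path qE (adj_sym DadjE) andbT.
by apply: sub_path qp => C C'; exact: arc_adj.
Qed.

(** * Cycles closed by common neighbors of the two halves *)

Lemma arc_special_next s n Y : arc s n (Sp n) Y -> Y <> Sp n ->
  adj n.+1 (AB s n.+1) Y.
Proof.
move=> /arcP[_ PY]; rewrite refine_special => h YS.
have [x sx] := classes_neq0 (AB_classes s n.+1); have [y xy Yy] := h x sx.
by apply/adjP; split=> //; [exact: classes_next | exists x, y].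
Qed.

Lemma triangle_free n X Y Z : adj n X Y -> adj n Y Z -> adj n Z X ->
  X <> Y -> X <> Z -> Y <> Z -> False.
Proof.
move=> XY YZ ZX nXY nXZ nYZ.
have /(@acyc n) : ucycle (adj n) [:: X; Y; Z]; last by [].
apply/andP; split; first by rewrite /= XY YZ ZX.
by rewrite !cons_uniq !in_cons !in_nil !orbF !negb_or;
  do ?[apply/andP; split] => //; case: pselect.
Qed.

Lemma square_free n X Y Z W :
  adj n X Y -> adj n Y Z -> adj n Z W -> adj n W X ->
  X <> Y -> X <> Z -> X <> W -> Y <> Z -> Y <> W -> Z <> W -> False.
Proof.
move=> XY YZ ZW WX nXY nXZ nXW nYZ nYW nZW.
have /(@acyc n) : ucycle (adj n) [:: X; Y; Z; W]; last by [].
apply/andP; split; first by rewrite /= XY YZ ZW WX.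
by rewrite !cons_uniq !in_cons !in_nil !orbF !negb_or;
  do ?[apply/andP; split] => //; case: pselect.
Qed.

(* Otherwise S_(n+1), which is adjacent to both, would close a cycle. *)
Lemma common_special s n Y : adj n.+1 (AB s n.+1) Y -> adj n.+1 (AB (~~ s) n.+1) Y ->
  Y <> AB s n.+1 -> Y <> AB (~~ s) n.+1 -> Y = Sp n.+1.
Proof.
move=> AY BY YA YB; apply: contrapT => YS.
have SA r := arc_adj (arc_AB r n.+1).
have AB' : AB s n.+1 <> AB (~~ s) n.+1 by exact: AB_neq.
have triangle : adj n.+1 (AB s n.+1) (AB (~~ s) n.+1) -> False.
  move=> AdjB; exact: (triangle_free AdjB BY (adj_sym AY) AB' (nesym YA) (nesym YB)).
have [SE|SE] := pselect (Sp n.+1 = AB s n.+1).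
  by apply: triangle; rewrite -SE.
have [SE'|SE'] := pselect (Sp n.+1 = AB (~~ s) n.+1).
  by apply: triangle; rewrite -SE'; apply: adj_sym; exact: SA.
by apply: (square_free AY (adj_sym BY) (adj_sym (SA (~~ s))) (SA s)) => //;
  exact: nesym.
Qed.

(** Fullness turns the edge from [Sp n] to [AB (~~ s) n] into an arc for s, by [VG_adj_arc]; it is
    one for [~~ s] anyway. Both halves are thus adjacent to this class at level n.+1, and
    [common_special] identifies it. *)
Lemma full_common s n : full s n -> AB (~~ s) n <> Sp n -> Sp n.+1 = AB (~~ s) n.
Proof.
move=> f BS; have VB : VG s n (AB (~~ s) n) by exact: full_classes.
have aB := arc_AB (~~ s) n.
have aA : arc s n (Sp n) (AB (~~ s) n).
  by apply: VG_adj_arc (arc_adj aB) => //; exact: nesym.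
have nAB r : AB (~~ s) n <> AB r n.+1.
  move=> BA; apply: BS; have [x Bx] := classes_neq0 (AB_classes (~~ s) n).
  apply: (classes_eq _ _ Bx) => //; apply: (@AB_sub r); by rewrite -BA.
by apply/esym; apply: (@common_special s) => //; exact: arc_special_next.
Qed.

(** * Critical levels and full graphs *)

Lemma CnE n x : Sp n.+1 x -> Cn e phi Sp n = cl n x.
Proof.
move=> Sx; rewrite /Cn; case: xgetP => [D -> [y [<- yS]]|].
  apply: (@ball_class_leq _ _ _ n n.+1) => //.
  by rewrite yS; exact: classesE.
by move=> /(_ (cl n x)) []; exists x; split=> //; apply/esym/classesE.
Qed.

(** The letter is switched: [AB s n] is special or central exactly when the graph of [~~ s] is
    full. *)
Lemma critical_full n : critical e phi Sp A B n <-> exists s, full s n.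
Proof.
have -> : critical e phi Sp A B n <->
    exists s, AB s n = Sp n \/ AB s n = Cn e phi Sp n.
  split=> [[AS|AC|BS|BC]|].
  - by exists true; left.
  - by exists true; right.
  - by exists false; left.
  - by exists false; right.
  - by move=> [[] [h|h]]; [apply: Or41|apply: Or42|apply: Or43|apply: Or44].
split=> [[s [sS|sC]]|[s f]].
- by exists (~~ s); apply: full_other; rewrite negbK sS.
- have [SS|SS] := pselect (AB s n = Sp n).
    by exists (~~ s); apply: full_other; rewrite negbK SS.
  (* Some point of [Sp n.+1], lying in [AB s n], is adjacent to a point of [AB (~~ s) n.+1]; read
     backwards, this is an arc from [Sp n] to [AB s n] for [~~ s]. *)
  have /arcP[_ _ SB] := arc_AB (~~ s) n.+1.
  have [x Rx] := classes_neq0 (refine_classes (~~ s) (special_classes n.+1)).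
  have [y xy By] := SB x Rx; have Sx := refine_sub Rx.
  exists (~~ s); apply: full_other; rewrite negbK.
  apply: (VG_arc (VG_special _ _)); apply: (arcI (x := y) (y := x)) => //.
  + by rewrite refine_special.
  + by rewrite e_sym.
  + by rewrite sC (CnE Sx); exact: ball_class_self.
- exists (~~ s); have [|BS] := pselect (AB (~~ s) n = Sp n); first by left.
  right; have SE := full_common f BS.
  have [x Sx] := classes_neq0 (special_classes n.+1).
  by rewrite (CnE Sx); apply: classesE => //; rewrite -SE.
Qed.

(** * Levels at which both graphs are full *)

(** The special class carries a loop, and its only other possible neighbor is [AB (~~ s) n]. This
    consequence of a tie has the merit of passing to lower levels. *)
Definition leaf s n : Prop := AB s n = Sp n /\
  forall Z, adj n (Sp n) Z -> Z = AB true n \/ Z = AB false n.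

(** All neighbors of [Sp n.+1] lie inside [Sp n]. This applies to a point of [AB s n] next to
    [AB s n.+1], whence [AB s n = Sp n]; a further neighbor of [Sp n] would stay adjacent to
    [AB s n.+1] while lying outside [Sp n]. *)
Lemma leaf_prev s n : leaf s n.+1 -> leaf s n.
Proof.
move=> [sS nbrS].
have nbr_sub Z : adj n.+1 (Sp n.+1) Z -> Z `<=` Sp n.
  by move=> /nbrS[] ->; exact: AB_sub.
have sSn : AB s n = Sp n.
  have [x sx] := classes_neq0 (AB_classes s n.+1).
  have [y xy sy] := adjacent_AB sx.
  apply: (classes_eq _ _ sy) => //.
  apply: (nbr_sub (cl n.+1 y)); last exact: ball_class_self.
  by rewrite -sS; apply/adjP; split=> //; exists x, y; split=> //; exact: ball_class_self.
split=> // Z SZ; apply: contrapT => /not_orP[Zt Zf].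
have ZS : Z <> Sp n by rewrite -sSn; case: (s).
have := arc_special_next (arc_common s SZ Zt Zf) ZS; rewrite sS => /nbr_sub ZsubS.
have /adjP[_ PZ [_ [z [_ Zz _]]]] := SZ.
by apply: ZS; apply: (classes_eq PZ _ Zz) => //; exact: ZsubS.
Qed.

Lemma leaf_leq s m n : m <= n -> leaf s n -> leaf s m.
Proof.
move=> /subnK <-; elim: (n - m) => // k IH; rewrite addSn => /leaf_prev; exact: IH.
Qed.

(** The descent ends at level 0, where the naming makes [A 0] special. *)
Lemma leaf_true s n : leaf s n -> s.
Proof.
move=> /(leaf_leq (leq0n n))[]; case: s => //; rewrite (naming_S0 nam) => H.
by case: (@AB_neq false 0).
Qed.

(** Some [AB s n] is special, since otherwise [full_common] would give [Sp n.+1] two values. A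
    further neighbor of [Sp n] would be adjacent to both halves, hence equal to [Sp n.+1], which is
    [AB (~~ s) n]. *)
Lemma tie_leaf n : full true n -> full false n ->
  leaf true n /\ Sp n.+1 = AB false n.
Proof.
move=> ft ff; have f s : full s n by case: s.
have [s sS] : exists s, AB s n = Sp n.
  apply: contrapT => /forallNP nS; apply: (@AB_neq true n).
  exact: etrans (esym (full_common (f false) (nS true)))
    (full_common (f true) (nS false)).
have SE : Sp n.+1 = AB (~~ s) n.
  by apply: full_common => //; rewrite -sS; apply: nesym; exact: AB_neq.
suff ls : leaf s n by have st := leaf_true ls; rewrite st in ls SE.
split=> // Z SZ; apply: contrapT => /not_orP[Zt Zf].
have ZS : Z <> Sp n by rewrite -sS; case: (s).
have nAB r : Z <> AB r n.+1.
  have /adjP[_ PZ [_ [z [_ Zz _]]]] := SZ.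
  by move=> ZA; apply: ZS; apply: (classes_eq PZ _ Zz) => //; rewrite ZA in Zz; exact: AB_sub Zz.
have : Z = Sp n.+1.
  by apply: (@common_special s) => //; apply: arc_special_next => //; exact: arc_common.
by rewrite SE; case: (s).
Qed.

(** The tie at m gives [Sp m.+1 = AB false m] and [AB true m = Sp m]. The later one descends to
    [AB true m.+1 = Sp m.+1], contained in [Sp m]: two disjoint classes would meet. *)
Lemma tie_unique m n : m < n -> full true m -> full false m ->
  full true n -> full false n -> False.
Proof.
move=> mn tm fm tn fn; have [_ SE] := tie_leaf tm fm.
have [[AS _] _] := tie_leaf tm fm.
have [/(leaf_leq mn)[AS' _] _] := tie_leaf tn fn.
have [x Sx] := classes_neq0 (special_classes m.+1).
apply: (@AB_neq true m); apply: (@classes_eq m _ _ x) => //; last by rewrite -SE.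
rewrite [AB true m]AS; apply: (@AB_sub true); by rewrite [AB true _]AS'.
Qed.

(** Without critical levels from n on, the set [Q j] of classes common to both graphs decreases and
    loses its element [Sp j] at each step. The later special classes would be infinitely many
    distinct classes of n-balls; n+3 of them are enough for a contradiction. *)
Lemma critical_unbounded n : exists2 m, n <= m & critical e phi Sp A B m.
Proof.
apply: contrapT => nc.
have nf s j : n <= j -> ~ full s j.
  by move=> nj f; apply: nc; exists j => //; apply/critical_full; exists s.
pose Q j := [set D | VG true j D /\ VG false j D].
have QS j D : n <= j -> Q j.+1 D -> Q j D /\ D <> Sp j.
  move=> nj [Vt Vf].
  have [PD DS] : P j D /\ D <> Sp j.
    apply: classes_prev; first exact: VG_classes Vt.
      by move=> DA; apply: (@nf false j.+1); [exact: leqW|apply: full_other; rewrite -DA].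
    by move=> DA; apply: (@nf true j.+1); [exact: leqW|apply: full_other; rewrite -DA].
  split=> //; have [x Dx] := classes_neq0 PD.
  rewrite (classesE (classes_next PD DS) Dx) in Vt Vf.
  by rewrite (classesE PD Dx); split; apply: VG_prev => //; apply: nf; exact: leqW.
have Qle i j D : n <= i -> i <= j -> Q j D -> Q i D.
  move=> ni /subnK <-; elim: (j - i) => // k IH; rewrite addSn.
  by move=> /QS[|QD _]; [exact: leq_trans (leq_addl _ _)|exact: IH].
have Qne i j : n <= i -> i < j -> Sp j <> Sp i.
  move=> ni ij; have QSj : Q j (Sp j) by [].
  by have /(QS _ _ ni)[] := Qle i.+1 j _ (leqW ni) ij QSj.
have finP : finite_set (P n) by apply/finite_setP; exists n.+2; exact: sturm.
pose l := [seq Sp (n + j) | j <- iota 0 n.+3].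
have : size l <= size (enum_fset (fset_set (P n))).
  apply: uniq_leq_size.
    rewrite map_inj_in_uniq ?iota_uniq // => i j _ _ Sij.
    apply/eqP; case: ltngtP => // ij; exfalso.
      by apply: (@Qne (n + i) (n + j)); rewrite ?ltn_add2l ?leq_addr.
    by apply: (@Qne (n + j) (n + i)); rewrite ?ltn_add2l ?leq_addr.
  move=> D /mapP[j _ ->]; rewrite in_fset_set // mem_set //.
  have QSj : Q (n + j) (Sp (n + j)) by [].
  by have [/VG_classes] := Qle n _ _ (leqnn n) (leq_addr j n) QSj.
by rewrite (card_fset_set (sturm n)) size_map size_iota ltnn.
Qed.

(** * Critical levels and the letters alpha, beta *)

Local Notation crit := (critical e phi Sp A B).
Local Notation level := (Defs.level e phi Sp A B).
Local Notation alpha := (Defs.alpha e phi Sp A B).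
Local Notation beta := (Defs.beta e phi Sp A B).

Definition nb_critical n := count (fun m => `[< crit m >]) (iota 0 n).

Lemma nb_criticalS n : nb_critical n.+1 = nb_critical n + `[< crit n >].
Proof. by rewrite /nb_critical -addn1 iotaD count_cat /= add0n addn0. Qed.

Lemma nb_critical_leq m n : m <= n -> nb_critical m <= nb_critical n.
Proof.
move=> /subnK <-; elim: (n - m) => // k IH.
by rewrite addSn nb_criticalS; apply: leq_trans IH _; exact: leq_addr.
Qed.

Lemma nb_critical_lt m n : crit m -> m < n -> nb_critical m < nb_critical n.
Proof.
move=> cm /nb_critical_leq; apply: leq_trans.
by rewrite nb_criticalS asboolT // addn1.
Qed.

Lemma nb_critical_const m n : m <= n -> (forall j, m <= j < n -> ~ crit j) ->
  nb_critical n = nb_critical m.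
Proof.
move=> /subnK <-; elim: (n - m) => // k IH nc.
rewrite addSn nb_criticalS asboolF ?addn0; last first.
  by apply: nc; rewrite addSn leqnn andbT leq_addl.
apply: IH => j /andP[mj jk]; apply: nc.
by rewrite mj addSn (leq_trans jk) // leqnSn.
Qed.

Lemma critical0 : crit 0.
Proof. by apply: Or41; rewrite (naming_S0 nam). Qed.

Lemma nb_critical_ex k : exists n, crit n /\ nb_critical n = k.
Proof.
elim: k => [|k [n [cn nk]]]; first by exists 0; split; [exact: critical0|].
have ex : exists m, (n < m) && `[< crit m >].
  have [m nm cm] := critical_unbounded n.+1.
  by exists m; rewrite nm; exact/asboolP.
case: (ex_minnP ex) => m /andP[nm /asboolP cm] min; exists m; split=> //.
rewrite (nb_critical_const nm); first by rewrite nb_criticalS asboolT // addn1 nk.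
move=> j /andP[nj jm] cj.
by have := min j; rewrite nj leqNgt jm asboolT // => /(_ isT).
Qed.

Lemma levelP k : crit (level k) /\ nb_critical (level k) = k.
Proof.
rewrite /Defs.level; case: xgetP => [n _ //|] nk.
by have [n] := nb_critical_ex k; case/(nk n).
Qed.

Lemma level_lt k : level k < level k.+1.
Proof.
have [_ ck] := levelP k; have [_ ck1] := levelP k.+1.
by rewrite ltnNge; apply/negP => /nb_critical_leq; rewrite ck ck1 ltnn.
Qed.

Lemma nb_critical_level n : crit n -> level (nb_critical n) = n.
Proof.
move=> cn; have [cl' nl] := levelP (nb_critical n).
apply/eqP; case: ltngtP => // [/(nb_critical_lt cl')|/(nb_critical_lt cn)];
  by rewrite nl ltnn.
Qed.

Lemma noncritical k j : level k < j < level k.+1 -> ~ crit j.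
Proof.
move=> /andP[kj jk] cj; have [ck nk] := levelP k; have [_ nk1] := levelP k.+1.
have := nb_critical_lt ck kj; have := nb_critical_lt cj jk.
by rewrite nk nk1 ltnS => jk' kj'; have := leq_trans kj' jk'; rewrite ltnn.
Qed.

Lemma not_full k j s : level k < j < level k.+1 -> ~ full s j.
Proof. by move=> kj f; apply: (noncritical kj); apply/critical_full; exists s. Qed.

(* The k such that n_k <= n < n_(k+1). *)
Definition stage_of n := (nb_critical n.+1).-1.

Lemma stage_ofE k n : level k <= n < level k.+1 -> stage_of n = k.
Proof.
move=> /andP[kn nk]; have [ck ek] := levelP k; have [_ ek1] := levelP k.+1.
have := nb_critical_leq nk; rewrite -ltnS in kn.
have := nb_critical_lt ck kn; rewrite /stage_of ek ek1.
by case: nb_critical => // c; rewrite !ltnS => ? ?; apply/eqP; rewrite eqn_leq; apply/andP.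
Qed.

Lemma stage_ofP n : level (stage_of n) <= n < level (stage_of n).+1.
Proof.
elim: n => [|n IH].
  have l0 : level 0 = 0 by exact: (nb_critical_level critical0).
  have := level_lt 0; rewrite l0 => l1.
  by rewrite (@stage_ofE 0) ?l0.
have [cn|cn] := pselect (crit n.+1).
  have ln := nb_critical_level cn; have := level_lt (nb_critical n.+1).
  rewrite ln => ln1.
  by rewrite (@stage_ofE (nb_critical n.+1)) ?ln ?leqnn.
have lt : level (stage_of n) <= n.+1 < level (stage_of n).+1.
  case/andP: IH => kn; rewrite (leqW kn) leq_eqVlt => /orP[/eqP nk|//].
  by case: cn; rewrite nk; have [] := levelP (stage_of n).+1.
by rewrite (stage_ofE lt).
Qed.

Lemma alpha_true k : full true (level k) -> alpha k.
Proof.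
by move=> f; apply: subset_card_le => D /VG_classes; exact: full_classes.
Qed.

Lemma alpha_false k : ~ full true (level k) -> full false (level k) ->
  alpha k = false.
Proof.
set n := level k => nf f; apply/negP; rewrite /Defs.alpha -/n => le.
have sub : VG true n `<=` VG false n by move=> D /VG_classes; exact: full_classes.
have fin r : finite_set (VG r n).
  by apply: (sub_finite_set (@VG_classes r n)); apply/finite_setP; exists n.+2; exact: sturm.
have : (VG true n #= VG false n)%card by rewrite card_eq_le subset_card_le.
move/(fcard_eq (fin _) (fin _)) => card.
suff VE : VG true n = VG false n by apply: nf => x; rewrite VE.
apply: fset_set_inj => //; apply/eqP.
by rewrite eqEfcard card leqnn andbT -fset_set_sub.
Qed.

(** At a critical level one graph is full, and comparing cardinalities selects a full one. *)
Lemma full_alpha k : full (alpha k) (level k).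
Proof.
have [ft|ft] := pselect (full true (level k)); first by rewrite alpha_true.
have [/critical_full[[] f] _] := levelP k; first by case: ft.
by rewrite alpha_false.
Qed.

(** * The letters seen from the base vertex *)

Section Base.
Variable t : V.

Lemma beta_mem k : VG (beta t k) (level k.+1) (cl (level k.+1) t).
Proof.
by rewrite /Defs.beta; case: ifP => [/asboolP//|_]; exact: full_alpha.
Qed.

Lemma beta_major k : ~ full (~~ beta t k) (level k.+1) ->
  ~ VG (~~ beta t k) (level k.+1) (cl (level k.+1) t).
Proof.
rewrite /Defs.beta; case: ifP => [_|/asboolPn //].
by rewrite negbK => /(_ (full_alpha _)).
Qed.

Lemma beta_tie k : full true (level k.+1) -> full false (level k.+1) ->
  beta t k = false.
Proof. by move=> ft ff; rewrite /Defs.beta alpha_true //= asboolT. Qed.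

(** As [VG s j] contains [Sp j], the vertex t avoids the special classes, so [refine] leaves its
    class unchanged. *)
Lemma VG_stay s m n : m <= n -> VG (~~ s) m (cl m t) ->
  (forall j, m <= j < n -> ~ VG s j (cl j t)) -> VG (~~ s) n (cl n t).
Proof.
move=> /subnK <-; elim: (n - m) => // k IH Vm nV.
have {}IH : VG (~~ s) (k + m) (cl (k + m) t).
  apply: IH Vm _ => j /andP[mj jk]; apply: nV.
  by rewrite mj addSn (leq_trans jk) // leqnSn.
have := refine_VG IH; rewrite addSn -refine_class // => St.
case: (nV (k + m)); first by rewrite leq_addl addSn leqnn.
by rewrite -(classesE _ St).
Qed.

Lemma VG_back s m n x : m <= n -> (forall i, m < i <= n -> ~ full s i) ->
  VG s n (cl n x) -> VG s m (cl m x).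
Proof.
move=> /subnK <-; elim: (n - m) => // k IH nf; rewrite addSn => /VG_prev Vk.
apply: IH => [i /andP[mi ik]|]; first by apply: nf; rewrite mi addSn leqW.
by apply: Vk; apply: nf; rewrite addSn leqnn ltnS leq_addl.
Qed.

(** [VG_back] pulls [beta_mem] back unless the graph of [beta t k] is full at the next critical
    level. If both are full there, the letter is B and [tie_leaf] makes its graph full already at
    [level k]. Otherwise t would stay in the other graph, against [beta_major]. *)
Lemma VG_beta k : VG (beta t k) (level k) (cl (level k) t).
Proof.
apply: contrapT => nV; set s := beta t k in nV.
have lk := ltnW (level_lt k).
have [fs|fs] := pselect (full s (level k.+1)); last first.
  apply: nV; apply: (VG_back lk _ (beta_mem k)) => i /andP[ki].
  rewrite leq_eqVlt => /orP[/eqP -> //|ik]; apply: (@not_full k).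
  by rewrite ki.
have [fs'|fs'] := pselect (full (~~ s) (level k.+1)).
  have [ft ff] : full true (level k.+1) /\ full false (level k.+1).
    by case: (s) fs fs'.
  have sF : s = false by exact: beta_tie.
  have [/(leaf_leq lk)[AS _] _] := tie_leaf ft ff.
  apply: nV; rewrite sF; apply: full_other; rewrite [AB _ _]AS.
  exact: VG_special.
apply: (beta_major fs'); apply: (VG_stay lk).
  by have [|//] := VG_cover s (level k) t.
move=> j /andP[kj jk] Vj; apply: nV; apply: (VG_back kj _ Vj).
by move=> i /andP[ki ij]; apply: (@not_full k); rewrite ki (leq_ltn_trans ij).
Qed.

(** If the graph of [beta t k.+1] is not full, this letter differs from [alpha k.+1], and by
    [VG_beta] it passes the test defining [beta t k]: the two letters agree. *)
Lemma VG_beta_next k D : VG (beta t k) (level k.+1) D ->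
  VG (beta t k.+1) (level k.+1) D.
Proof.
move=> VD; have [f|nf] := pselect (full (beta t k.+1) (level k.+1)).
  by apply: full_classes => //; exact: VG_classes VD.
have aE : alpha k.+1 = ~~ beta t k.+1.
  have := full_alpha k.+1; case: (alpha k.+1) (beta t k.+1) nf => [] [] //.
suff -> : beta t k.+1 = beta t k by [].
rewrite [RHS]/Defs.beta aE negbK asboolT //; exact: VG_beta.
Qed.

(** Suppose t is in the other half. A later graph of [beta t k] containing t would, pulled back to
    m.+1, contain [AB (~~ s) m.+1] and be full there. This excludes t from that graph, so either
    [beta_mem] fails or t stays in the other graph, against [beta_major]. *)
Lemma beta_special k m : ~ (full true (level k.+1) /\ full false (level k.+1)) ->
  level k <= m < level k.+1 -> Sp m t -> AB (beta t k) m.+1 t.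
Proof.
move=> notie /andP[km mk] Sm; apply: contrapT => nA.
set s := beta t k in nA; have Bt := special_or Sm nA.
have VB : VG (~~ s) m.+1 (cl m.+1 t).
  by rewrite -(classesE (AB_classes _ _) Bt); apply: (VG_arc _ (arc_AB _ _)).
have nV j : m < j < level k.+1 \/ j = level k.+1 /\ ~ full s j -> ~ VG s j (cl j t).
  move=> mj Vj.
  have nfj i : m < i <= j -> ~ full s i.
    case: mj => [/andP[_ jk]|[-> nf]] /andP[mi].
      by move=> ij; apply: (@not_full k); rewrite (leq_ltn_trans km mi) (leq_ltn_trans ij).
    rewrite leq_eqVlt => /orP[/eqP -> //|ik]; apply: (@not_full k).
    by rewrite (leq_ltn_trans km mi).
  have mj' : m < j by case: mj => [/andP[]|[-> _]].
  apply: (nfj m.+1); first by rewrite leqnn.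
  apply: full_other; rewrite (classesE (AB_classes _ _) Bt).
  by apply: (VG_back mj' _ Vj) => i /andP[mi ij]; apply: nfj; rewrite ij ltnW.
have [fs|fs] := pselect (full s (level k.+1)).
  apply: (@beta_major k); first by move=> fs'; apply: notie; move: fs fs'; rewrite -/s; case: (s).
  apply: (VG_stay mk VB) => j mj; apply: nV; by left.
by apply: (nV (level k.+1)) (beta_mem k); right.
Qed.

(** Letters indexed by all levels, so that refinements can be followed one level at a time. *)
Definition sigma n := beta t (stage_of n).

Lemma sigma_level k n : level k <= n < level k.+1 -> sigma n = beta t k.
Proof. by move=> kn; rewrite /sigma (stage_ofE kn). Qed.

Lemma sigma_step n D : VG (sigma n) n D -> VG (sigma n.+1) n.+1 (refine (sigma n) n D).
Proof.
move=> /refine_VG; have /andP[kn nk] := stage_ofP n; move: nk.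
rewrite leq_eqVlt => /orP[/eqP nk|nk]; last first.
  by rewrite (@sigma_level (stage_of n) n.+1) // (leq_trans kn) // leqnSn.
rewrite (@sigma_level (stage_of n).+1 n.+1); last by rewrite nk leqnn level_lt.
by have := @VG_beta_next (stage_of n) (refine (sigma n) n D); rewrite -nk.
Qed.

(** N is beyond the only possible tie, so that [beta_special] applies at every later stage. *)
Lemma sigma_base : exists N, forall n, N <= n ->
  VG (sigma n) n (cl n t) /\ (Sp n t -> AB (sigma n) n.+1 t).
Proof.
have [N NP] : exists N, forall n, N <= n -> ~ (full true n /\ full false n).
  have [[n [ft ff]]|nt] := pselect (exists n, full true n /\ full false n).
    by exists n.+1 => m nm [ft' ff']; exact: tie_unique nm ft ff ft' ff'.
  by exists 0 => n _ h; apply: nt; exists n.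
exists N => n Nn; have kn := stage_ofP n; have /andP[kn' nk] := kn.
set k := stage_of n in kn kn' nk.
have notie : ~ (full true (level k.+1) /\ full false (level k.+1)).
  by apply: NP; apply: leq_trans Nn _; exact: ltnW.
split; last exact: beta_special notie kn.
rewrite /sigma -/k; move: kn' nk => /subnK <-.
elim: (n - level k) => [|j IH] jk; first exact: VG_beta.
have jk' : j + level k < level k.+1 by apply: leq_ltn_trans jk; rewrite addSn.
have := refine_VG (IH jk'); rewrite addSn -refine_class //.
by apply: beta_special => //; rewrite jk' leq_addl.
Qed.


(** * Following the letters *)

Definition followed x n := forall m, n <= m ->
  VG (sigma m) m (cl m x) /\ cl m.+1 x = refine (sigma m) m (cl m x).

Lemma followed_base : exists n, followed t n.
Proof.
have [N NP] := sigma_base; exists N => m /NP[Vm Sm]; split=> //.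
exact: refine_class.
Qed.

(** At most one of D and E is special, so the edge can be read as an arc ending at a nonspecial
    class, which refinement does not change. *)
Lemma refine_adj s n D E : VG s n D -> VG s n E -> D <> E -> adj n D E ->
  adj n.+1 (refine s n D) (refine s n E).
Proof.
move=> VD VE DE DadjE.
have go C F : VG s n C -> VG s n F -> C <> F -> adj n C F -> F <> Sp n ->
    adj n.+1 (refine s n C) (refine s n F).
  move=> VC VF CF CadjF FS; have /arcP[PC PF h] := VG_adj_arc VC VF CF CadjF.
  have [x Cx] := classes_neq0 (refine_classes s PC); have [y xy Fy] := h x Cx.
  apply/adjP; split; [exact: refine_classes|exact: refine_classes|].
  by exists x, y; rewrite (refine_other _ FS).
have [ES|ES] := pselect (E = Sp n); last exact: go.
apply: adj_sym; apply: go => //; [exact: nesym|exact: adj_sym|].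
by rewrite -ES.
Qed.

(** If y fell in the wrong half of [Sp m], the class of x would stay adjacent to the right half.
    This gives a neighbor z of x equivalent to y at level m but not at m.+1, which is impossible
    beyond N. *)
Lemma followed_neighbor x y n : followed x n -> e x y -> exists m, followed y m.
Proof.
move=> fx xy; have [N sep] := nbrs_separate phi nbrs_finite x y.
exists (maxn n N) => m; rewrite geq_max => /andP[nm Nm].
have [Vx xS] := fx m nm; have [Vx1 xS1] := fx m.+1 (leqW nm).
have rx : refine (sigma m) m (cl m x) x by rewrite -xS; exact: ball_class_self.
have Vy : VG (sigma m) m (cl m y).
  apply: (VG_arc Vx); apply: (arcI _ _ rx xy) => //; exact: ball_class_self.
split=> //; apply: refine_class => Sy; apply: contrapT => ny.
have yS : cl m y = Sp m by apply/esym/classesE.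
have xny : cl m x <> cl m y.
  move=> xy'; apply: ny; have := sep x (or_introl erefl) m Nm xy' m.+1.
  rewrite xS xy' yS refine_special => ->; exact: ball_class_self.
have adjxy : adj m (cl m x) (cl m y).
  by apply/adjP; split=> //; exists x, y; split=> //; exact: ball_class_self.
have := refine_adj Vx Vy xny adjxy; rewrite -xS yS refine_special => adj1.
have VE : VG (sigma m.+1) m.+1 (AB (sigma m) m.+1).
  by rewrite -refine_special -yS; exact: sigma_step.
have nE : cl m.+1 x <> AB (sigma m) m.+1.
  move=> xA; apply: xny; rewrite yS; apply/esym/classesE => //.
  by apply: (@AB_sub (sigma m)); rewrite -xA; exact: ball_class_self.
have /arcP[_ _ h] := VG_adj_arc Vx1 VE nE adj1.
have [z xz Az] : exists2 z, e x z & AB (sigma m) m.+1 z.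
  by apply: h; rewrite -xS1; exact: ball_class_self.
have zy : cl m z = cl m y by rewrite yS; apply/esym/classesE => //; exact: AB_sub Az.
apply: ny; have := sep z (or_intror xz) m Nm zy m.+1.
rewrite -(classesE (AB_classes _ _) Az) => ->; exact: ball_class_self.
Qed.

Lemma followed_all x : exists n, followed x n.
Proof.
apply: (@connected_ind (fun x => exists n, followed x n) t) x.
  exact: followed_base.
by move=> y z [n fy] yz; exact: followed_neighbor fy yz.
Qed.

Definition track n m D := iteri (m - n) (fun j => refine (sigma (n + j)) (n + j)) D.

Lemma track_refl n D : track n n D = D.
Proof. by rewrite /track subnn. Qed.

Lemma trackS n m D : n <= m -> track n m.+1 D = refine (sigma m) m (track n m D).
Proof. by move=> nm; rewrite /track subSn //= subnKC. Qed.

Lemma track_trans n m k D : n <= m -> m <= k -> track n k D = track m k (track n m D).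
Proof.
move=> nm /subnK <-; elim: (k - m) => [|j IH]; first by rewrite add0n track_refl.
by rewrite addSn !trackS ?leq_addl ?IH // (leq_trans nm) // leq_addl.
Qed.

Lemma VG_track n m D : n <= m -> VG (sigma n) n D -> VG (sigma m) m (track n m D).
Proof.
move=> /subnK <- VD; elim: (m - n) => [|k IH]; first by rewrite add0n track_refl.
by rewrite addSn trackS ?leq_addl //; exact: sigma_step.
Qed.

Lemma track_sub n m k D : n <= m -> m <= k -> track n k D `<=` track n m D.
Proof.
move=> nm /subnK <-; elim: (k - m) => [|j IH] x; first by rewrite add0n.
rewrite addSn trackS; last by rewrite (leq_trans nm) // leq_addl.
by move=> /refine_sub /IH.
Qed.

Lemma track_followed x n m : followed x n -> n <= m -> track n m (cl n x) = cl m x.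
Proof.
move=> fx /subnK <-; elim: (m - n) => [|k IH]; first by rewrite add0n track_refl.
by rewrite addSn trackS ?leq_addl // IH; case: (fx (k + n)); rewrite ?leq_addl.
Qed.

(** At each level x has a neighbor in the refinement of E. An ultrafilter selects one of these
    finitely many neighbors; as the refinements decrease, it lies in all of them. *)
Lemma track_neighbor n D E x : VG (sigma n) n D -> VG (sigma n) n E -> adj n D E ->
  (forall m, n <= m -> track n m D x) -> exists y, forall m, n <= m -> track n m E y.
Proof.
move=> VD VE DadjE Dx; have [<-|DE] := pselect (D = E); first by exists x.
have neq m : n <= m -> track n m D <> track n m E.
  move=> nm TE; apply: DE.
  apply: (classes_eq (x := x) (VG_classes VD) (VG_classes VE)).
    by rewrite -(track_refl n D); exact: Dx.
  rewrite -(track_refl n E); apply: (track_sub (leqnn n) nm); rewrite -TE.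
  exact: Dx.
have adjm m : n <= m -> adj m (track n m D) (track n m E).
  move=> /subnK <-; elim: (m - n) => [|k IH]; first by rewrite add0n !track_refl.
  rewrite addSn !trackS ?leq_addl //; apply: refine_adj => //.
  - by apply: VG_track => //; exact: leq_addl.
  - by apply: VG_track => //; exact: leq_addl.
  - by apply: neq; exact: leq_addl.
have /choice[y yP] m : exists y, n <= m -> e x y /\ track n m E y.
  have [nm|] := leqP n m; last by exists x.
  have /arcP[_ _ h] : arc (sigma m) m (track n m D) (track n m E).
    by apply: VG_adj_arc; [exact: VG_track|exact: VG_track|exact: neq|exact: adjm].
  have [y xy Ey] : exists2 y, e x y & track n m E y.
    by apply: h; rewrite -trackS //; apply: Dx; exact: leqW.
  by exists y.
have [U [UU sU]] := ultraFilterLemma eventually_filter.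
have large N : U [set m | N <= m] by apply: sU; exists N.
have [z zP] : exists z, U [set m | y m = z].
  apply: (ultra_finite UU (nbrs_finite x)).
  by apply: filterS (large n) => m /yP[].
exists z => m nm.
have [k [/= yk mk]] := filter_ex (filterI zP (large m)).
rewrite -yk; apply: (track_sub nm mk).
by have [] := yP k (leq_trans nm mk).
Qed.

(** From some level M on t lies in all refinements of its class, and [track_neighbor] carries this
    property along arcs in both directions, through [Sp M]. *)
Lemma track_point n D : VG (sigma n) n D ->
  exists x, forall m, n <= m -> track n m D x.
Proof.
move=> VD; have [N ft] := followed_base; set M := maxn n N.
have nM : n <= M := leq_maxl n N; have NM : N <= M := leq_maxr n N.
pose Q E := exists x, forall m, M <= m -> track M m E x.
have ftM : followed t M by move=> m Mm; apply: ft; exact: leq_trans Mm.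
have [Vt _] := ftM M (leqnn M).
have QS : forall E, VG (sigma M) M E -> (Q E <-> Q (Sp M)).
  apply: VG_ind => // C E VC CS CE; have VE := VG_arc VC CE.
  rewrite -CS; split=> -[x xP].
    apply: (track_neighbor VE VC _ xP); exact: adj_sym (arc_adj CE).
  exact: track_neighbor VC VE (arc_adj CE) xP.
have Qt : Q (cl M t).
  by exists t => m Mm; rewrite (track_followed ftM Mm); exact: ball_class_self.
have VDM := VG_track nM VD.
have [x xP] : Q (track n M D) by apply/(QS _ VDM)/(QS _ Vt).
exists x => m nm; have [Mm|mM] := leqP M m.
  by rewrite (track_trans _ nM Mm); exact: xP.
apply: (track_sub nm (ltnW mM)); rewrite -[track n M D](track_refl M).
exact: xP.
Qed.

(** Beyond N, a neighbor of x equivalent to y at level m is so at every level, hence is in the orbit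
    of y. *)
Lemma nb_orbit x y : exists N, forall m, N <= m ->
  nb x (cl m y) = nb x (aut_orbit e phi y).
Proof.
have [N sep] := nbrs_separate phi nbrs_finite x y; exists N => m Nm.
have ball z w : exists n, vball e n z w.
  by have [p pp pw] := conn z w; exists (size p), p.
apply/eqP; rewrite eqn_leq; apply/andP; split; apply: nb_neighbors_le => // u xu.
  move=> /ball_classP uy; apply: class_orbit => // k.
  by apply/esym; exact: sep (or_intror xu) m Nm uy k.
by move=> yu; apply/ball_classP/esym; exact: orbit_class.
Qed.

(** * The direct system, its points and its indices *)

Local Notation G := (ball_system e phi Sp A B t).

Lemma color_classE n D x : P n D -> D x -> class_color phi D = phi x.
Proof.
move=> PD Dx; apply/asboolP/idP => [[y Dy py]|]; last by exists x.
have : cl 0 x y.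
  apply/ball_classP; apply: (@ball_class_leq _ _ _ 0 n) => //.
  by rewrite -(classesE PD Dx) -(classesE PD Dy).
by rewrite color_class0 => /= <-.
Qed.

(** A nonspecial class has the same centers as its unique extension. *)
Lemma ext_refine s n D : P n D -> ext e phi Sp A B s n D = refine s n D.
Proof.
move=> PD; rewrite /ext /refine; case: eqP => // DS.
have [x Dx] := classes_neq0 PD.
have xD : cl n.+1 x = D by apply/esym/classesE => //; exact: classes_next.
case: xgetP => [E -> [y [yD yE]]|/(_ D)[]].
  rewrite -yE; apply/esym/classesE; first exact: classes_next.
  by rewrite -yD; exact: ball_class_self.
by exists x; split=> //; apply/esym/classesE.
Qed.

Lemma level_leq k m : k <= m -> level k <= level m.
Proof.
move=> /subnK <-; elim: (m - k) => // j IH; rewrite addSn.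
exact: leq_trans IH (ltnW (level_lt _)).
Qed.

Lemma leq_level k : k <= level k.
Proof. by elim: k => // k IH; apply: leq_ltn_trans (level_lt k). Qed.

Lemma sigma_at k : sigma (level k) = beta t k.
Proof. by apply: sigma_level; rewrite leqnn level_lt. Qed.

Lemma transition_track k D : VG (beta t k) (level k) D ->
  @transition G k D = track (level k) (level k.+1) D.
Proof.
rewrite -sigma_at => VD; rewrite /=.
have -> : level k.+1 = level k + (level k.+1 - level k).
  by rewrite subnKC //; exact/ltnW/level_lt.
rewrite addKn.
have : level k + (level k.+1 - level k) <= level k.+1.
  by rewrite subnKC //; exact/ltnW/level_lt.
elim: (level k.+1 - level k) => [|j IH] jk; first by rewrite addn0 track_refl.
rewrite addnS in jk *; rewrite trackS ?leq_addr //= IH ?(ltnW jk) //.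
rewrite (@sigma_level k (level k + j)) ?leq_addr // ext_refine //.
apply: VG_classes; apply: VG_track VD; exact: leq_addr.
Qed.

Lemma push_track k m D : k <= m -> VG (beta t k) (level k) D ->
  @push G k m D = track (level k) (level m) D.
Proof.
move=> /subnK <- VD; rewrite /push addnK.
elim: (m - k) => [|j IH]; first by rewrite add0n track_refl.
have lkj : level k <= level (j + k) by apply: level_leq; exact: leq_addl.
rewrite iteriS IH [k + j]addnC transition_track; last first.
  by rewrite -sigma_at; apply: VG_track; rewrite ?sigma_at.
rewrite addSn -track_trans //; exact/ltnW/level_lt.
Qed.

Lemma track_classE n D x m : VG (sigma n) n D ->
  (forall m, n <= m -> track n m D x) -> n <= m -> track n m D = cl m x.
Proof.
move=> VD xP nm; apply: classesE; last exact: xP.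
apply: VG_classes; exact: VG_track VD.
Qed.

(** The last clause lets indices be read at x: out of a special class, [idx] counts the neighbors of
    points of the selected half. *)
Lemma stage_point (p : stage_vertex G) : exists x, forall m, (sval p).1 <= m ->
  VG (beta t m) (level m) (cl (level m) x) /\
  (push_vertex p m = cl (level m) x /\
   refine (beta t m) (level m) (cl (level m) x) x).
Proof.
case: p => -[k D] /= VD0.
have VD : VG (sigma (level k)) (level k) D by rewrite sigma_at.
have [x xP] := track_point VD.
exists x => m km; have lkm := level_leq km.
have pE : push_vertex (G := G) (exist _ (k, D) VD0) m = cl (level m) x.
  by rewrite /push_vertex /= push_track //; exact: track_classE.
have TE := track_classE VD xP lkm.
split; last split.
- by rewrite -sigma_at -TE; exact: VG_track.
- by rewrite -pE.
- by rewrite -sigma_at -TE -trackS //; apply: xP; exact: leqW.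
Qed.


Lemma eventual_indexE (p q : stage_vertex G) x y :
  (forall m, (sval p).1 <= m -> [/\ VG (beta t m) (level m) (cl (level m) x),
     push_vertex p m = cl (level m) x &
     refine (beta t m) (level m) (cl (level m) x) x]) ->
  (forall m, (sval q).1 <= m -> push_vertex q m = cl (level m) y) ->
  eventual_index p q = [set nb x (aut_orbit e phi y)].
Proof.
move=> xP yP; have [N NP] := nb_orbit x y.
have idxN m : maxn N (maxn (sval p).1 (sval q).1) <= m ->
    @stage_index G m (push_vertex p m) (push_vertex q m) = nb x (aut_orbit e phi y).
  rewrite !geq_max => /and3P[Nm pm qm]; have [_ -> rx] := xP m pm.
  rewrite yP // -(NP (level m)); last exact: leq_trans Nm (leq_level m).
  exact: idxE.
apply/seteqP; split=> v.
  move=> [M MP]; rewrite -(MP _ (leq_maxl M (maxn N (maxn (sval p).1 (sval q).1)))).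
  by rewrite idxN // leq_maxr.
by move=> ->; exists (maxn N (maxn (sval p).1 (sval q).1)).
Qed.

Lemma ball_system_direct_limit : has_direct_limit G.
Proof.
have VT k D : VG (beta t k) (level k) D ->
    VG (beta t k.+1) (level k.+1) (track (level k) (level k.+1) D).
  rewrite -!sigma_at; apply: VG_track; exact/ltnW/level_lt.
split=> [k D VD|k D VD|p q].
- by rewrite transition_track //; exact: VT.
- rewrite transition_track //; have PT := VG_classes (VT k D VD).
  have [x Tx] := classes_neq0 PT.
  rewrite /= (color_classE PT Tx) (color_classE (VG_classes VD) (x := x)) //.
  rewrite -(track_refl (level k) D).
  exact: (track_sub (leqnn _) (ltnW (level_lt k))) Tx.
- have [x xP] := stage_point p; have [y yP] := stage_point q.
  exists (nb x (aut_orbit e phi y)); rewrite (@eventual_indexE p q x y) //.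
    by move=> m /xP[? []].
  by move=> m /yP[_ []].
Qed.

Lemma followed_stage x : exists p : stage_vertex G,
  forall m, (sval p).1 <= m -> push_vertex p m = cl (level m) x.
Proof.
have [n fx] := followed_all x; have ln := leq_level n.
have fxn : followed x (level n) by move=> m lm; apply: fx; exact: leq_trans lm.
have [Vx _] := fxn _ (leqnn _).
have Vx' : VG (beta t n) (level n) (cl (level n) x) by rewrite -sigma_at.
exists (exist (fun p => @stage G p.1 p.2) (n, cl (level n) x) Vx') => m nm.
by rewrite /push_vertex push_track // track_followed //; exact: level_leq.
Qed.

End Base.
End SturmianClasses.

(** * The isomorphism with the quotient graph *)

Lemma quot_repP (T : Type) (R : T -> set T) (q : quot R) : sval q = R (quot_rep q).
Proof. by rewrite /quot_rep; case: cid. Qed.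

Lemma quot_eq (T : Type) (R : T -> set T) (q r : quot R) : sval q = sval r -> q = r.
Proof.
case: q r => [C hC] [D hD] /= CD; subst D; congr exist; exact: Prop_irrelevance.
Qed.

Theorem theorem4p14 (V : choiceType) (e : rel V) (d : nat) (phi : V -> bool)
    (a : bool) (Sp A B : nat -> set V) (t : V) :
  regular_tree e d -> sturmian e phi -> acyclic e phi ->
  naming e phi a Sp A B ->
  has_direct_limit (ball_system e phi Sp A B t) /\
  isomorphic (direct_limit (ball_system e phi Sp A B t)) (quotient_graph e phi).
Proof.
move=> [e_sym e_irr nbrs conn _] sturm acyc nam.
have fin x : finite_set [set y | e x y] by apply/finite_setP; exists d; exact: nbrs.
have hdl : has_direct_limit (ball_system e phi Sp A B t).
  exact: (@ball_system_direct_limit V e phi a Sp A B).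
split=> //; set G := ball_system e phi Sp A B t in hdl *.
pose level := Defs.level e phi Sp A B.
have ge_level m : m <= level m by exact: (@leq_level V e phi a).
have ball z w : exists n, vball e n z w.
  by have [p pp pw] := conn z w; exists (size p), p.
(* The isomorphism is induced by p |-> orbit of [pt p], where [pt p] is a vertex of the tree lying
   in all refinements of p. *)
have /choice[pt ptP] (p : stage_vertex G) : exists x, forall m, (sval p).1 <= m ->
    [/\ Defs.VG e phi Sp A B (beta e phi Sp A B t m) (level m)
          (ball_class e phi (level m) x),
        push_vertex p m = ball_class e phi (level m) x &
        refine Sp A B (beta e phi Sp A B t m) (level m)
          (ball_class e phi (level m) x) x].
  have [x xP] := @stage_point V e phi a Sp A B e_sym e_irr fin conn sturm acyc nam t p.
  by exists x => m /xP[? []].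
have orbitP x y : aut_orbit e phi x y <->
    forall n, ball_class e phi n x = ball_class e phi n y.
  by split=> [xy n|]; [exact: orbit_class|exact: class_orbit].
have orbit_sym x y : aut_orbit e phi x y -> aut_orbit e phi y x.
  by move=> /orbitP xy; apply/orbitP => n; rewrite xy.
have orbit_eq x y : aut_orbit e phi x y -> aut_orbit e phi x = aut_orbit e phi y.
  move=> /orbitP xy; apply/seteqP.
  by split=> z /orbitP h; apply/orbitP => n; rewrite -h xy.
have orbit_refl x : aut_orbit e phi x x by apply/orbitP.
have large x y M : (forall m, M <= m ->
    ball_class e phi (level m) x = ball_class e phi (level m) y) ->
    aut_orbit e phi x y.
  move=> xy; apply/orbitP => n.
  apply: (ball_class_leq (n := level (maxn M n))); last by apply: xy; exact: leq_maxl.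
  exact: leq_trans (leq_maxr M n) (ge_level _).
have same_limitP p q : same_limit p q <-> aut_orbit e phi (pt p) (pt q).
  split=> [[m [pm qm pq]]|/orbitP pq]; last first.
    exists (maxn (sval p).1 (sval q).1); split; rewrite ?leq_maxl ?leq_maxr //.
    have [|_ -> _] := ptP p (maxn (sval p).1 (sval q).1); first exact: leq_maxl.
    by have [|_ -> _] := ptP q (maxn (sval p).1 (sval q).1); first exact: leq_maxr.
  have pushS (r : stage_vertex G) n : (sval r).1 <= n ->
      push_vertex r n.+1 = transition n (push_vertex r n).
    by move=> rn; rewrite /push_vertex /push subSn //= subnKC.
  apply: (large _ _ m) => n mn.
  have [|_ <- _] := ptP p n; first exact: leq_trans mn.
  have [|_ <- _] := ptP q n; first exact: leq_trans mn.
  elim: n mn => [|n IH]; first by rewrite leqn0 => /eqP <-.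
  rewrite leq_eqVlt => /orP[/eqP <- //|]; rewrite ltnS => mn.
  by rewrite !pushS ?IH // (leq_trans _ mn).
pose class_of x : quot (aut_orbit e phi) := exist _ (aut_orbit e phi x)
  (ex_intro _ x erefl).
pose f (u : quot (@same_limit G)) := class_of (pt (quot_rep u)).
have repf u : aut_orbit e phi (quot_rep (f u)) (pt (quot_rep u)).
  by rewrite -quot_repP /=; exact: orbit_refl.
exists f; split.
- rewrite -setTT_bijective; split=> //.
    move=> u v _ _ fuv; apply: quot_eq; rewrite !quot_repP.
    have uv : aut_orbit e phi (pt (quot_rep u)) (pt (quot_rep v)).
      have E : aut_orbit e phi (pt (quot_rep u)) = aut_orbit e phi (pt (quot_rep v)).
        exact: (congr1 sval fuv).
      by rewrite E; exact: orbit_refl.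
    by apply/seteqP; split=> w /same_limitP h; apply/same_limitP;
      move: h; rewrite (orbit_eq _ _ uv).
  move=> C _; have [x CE] := proj2_sig C.
  have [p pP] : exists p : stage_vertex G, forall m, (sval p).1 <= m ->
      push_vertex p m = ball_class e phi (level m) x.
    exact: (@followed_stage V e phi a Sp A B).
  have px : aut_orbit e phi (pt p) x.
    apply: (large _ _ (sval p).1) => m pm.
    by rewrite -pP //; have [] := ptP p m pm.
  pose u : quot (@same_limit G) := exist _ (same_limit p) (ex_intro _ p erefl).
  exists u => //; apply: quot_eq; rewrite CE /= -(orbit_eq _ _ px).
  apply: orbit_eq; apply/orbit_sym/same_limitP.
  have : sval u (quot_rep u).
    rewrite quot_repP; apply/same_limitP; exact: orbit_refl.
  by [].
- move=> u; have [|Vu pu _] := ptP (quot_rep u) (sval (quot_rep u)).1 => //.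
  have cx : ball_class e phi (level (sval (quot_rep u)).1) (pt (quot_rep u))
      (quot_rep (f u)).
    by apply/ball_classP; exact: orbit_class (repf u).
  rewrite /= -(color_classE e_irr (mem_classes _ _ _ _) cx) -pu.
  by rewrite /push_vertex /push subnn.
- move=> u v.
  have idxE : eventual_index (quot_rep u) (quot_rep v) =
      [set nb_neighbors e (pt (quot_rep u)) (aut_orbit e phi (pt (quot_rep v)))].
    apply: (@eventual_indexE V e phi a Sp A B) => // m /ptP[] //.
  rewrite /= idxE.
  have -> w : xget 0 [set w : nat] = w by case: xgetP => [_ _ //|/(_ w)[]].
  (* The representatives [quot_rep (f u)] and [pt (quot_rep u)] may be different points of an orbit;
     replacing the target orbit by its class at a common large level makes the two counts
     comparable. *)
  have [N1 N1P] := nb_orbit phi fin conn (quot_rep (f u)) (pt (quot_rep v)).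
  have [N2 N2P] := nb_orbit phi fin conn (pt (quot_rep u)) (pt (quot_rep v)).
  rewrite -(N1P (maxn N1 N2)) ?leq_maxl // -(N2P (maxn N1 N2)) ?leq_maxr //.
  by apply: nb_neighbors_class => //; exact: orbit_class (repf u).
Qed.
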